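(* For every $d\geq2$ there are a constant $\alpha_0=\alpha_0(d)>0$ and a separated net $X\subseteq\mathbb{R}^d$ such that $X$ is $\omega$-irregular for any modulus of continuity $\omega$ for which there is $a>0$ with $\omega(t)=t\bigl(\log\frac1t\bigr)^{\alpha_0}$ for all $t\in(0,a)$, and such that $X$ has natural density one.
   Context: A set $A\subseteq\mathbb{R}^d$ is a separated net (of $\mathbb{R}^d$) if there are $r,s>0$ such that $\|x-y\|_2\geq s$ for all distinct $x,y\in A$ and $\operatorname{dist}(z,A)\leq r$ for all $z\in\mathbb{R}^d$. The natural density of a separated net $X\subseteq\mathbb{R}^d$ is $\lim_{R\to\infty}\frac{|X\cap\overline{B}(\mathbf{0},R)|}{\mathcal{L}(\overline{B}(\mathbf{0},R))}$, provided that the limit exists; here $\overline B(\mathbf 0,R)$ is the closed Euclidean ball and $\mathcal{L}$ is Lebesgue measure. A modulus of continuity is a strictly increasing, concave function $\omega\colon(0,a)\to(0,\infty)$ (for some $a>0$) with $\lim_{t\to0}\omega(t)=0$. Convention: any condition involving a value of $\omega$ is imposed only when the argument lies in the domain of $\omega$ (the condition is void otherwise). Given separated nets $X,Y\subseteq\mathbb{R}^d$ and a modulus of continuity $\omega$, a mapping $f\colon X\to Y$ is a homogeneous $\omega$-mapping if there are constants $K>0$ and $a\in(0,1)$ such that $$\|f(x_2)-f(x_1)\|_2\leq KR\,\omega\left(\frac{\|x_2-x_1\|_2}{R}\right)$$ for all $R>0$ and all (distinct) $x_1,x_2\in X\cap B(\mathbf{0},R)$ with $\|x_2-x_1\|_2<aR$,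 where $B(\mathbf{0},R)$ is the open Euclidean ball. The net $X$ is $\omega$-regular with respect to $Y$ if there is a bijection $f\colon X\to Y$ such that both $f$ and $f^{-1}$ are homogeneous $\omega$-mappings; otherwise $X$ is $\omega$-irregular with respect to $Y$. When $Y=\mathbb{Z}^d$ one just says $\omega$-regular or $\omega$-irregular. *)

(* Defs.v *)
From mathcomp Require Import all_boot all_order all_algebra.
From mathcomp Require Import all_classical all_reals all_analysis.
Import Order.TTheory GRing.Theory Num.Theory.
Import numFieldNormedType.Exports.

Set Implicit Arguments.
Unset Strict Implicit.
Unset Printing Implicit Defensive.

Local Open Scope classical_set_scope.
Local Open Scope ring_scope.

(* The canonical norm of MathComp-Analysis on ['rV[R]_d] is the sup norm. *)
Definition norm2 (R : realType) (d : nat) (x : 'rV[R]_d) : R :=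
  Num.sqrt (\sum_(i < d) x ord0 i ^+ 2).

Definition oball2 (R : realType) (d : nat) (rho : R) : set 'rV[R]_d :=
  [set x | norm2 x < rho].

Definition cball2 (R : realType) (d : nat) (rho : R) : set 'rV[R]_d :=
  [set x | norm2 x <= rho].

(* Extended-real valued, so that the distance to the empty set is [+oo]. *)
Definition dist2 (R : realType) (d : nat) (z : 'rV[R]_d) (A : set 'rV[R]_d) :
  \bar R := ereal_inf [set (norm2 (z - x))%:E | x in A].

Definition separated_net (R : realType) (d : nat) (A : set 'rV[R]_d) : Prop :=
  exists r s : R,
    [/\ 0 < r, 0 < s,
        forall x y, A x -> A y -> x != y -> s <= norm2 (x - y)
      & forall z, (dist2 z A <= r%:E)%E].

(* [d]-fold iterate of the product of measures [\x], transported along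
   (x, v) |-> x :: v; all the intermediate set functions are sigma-finite
   measures. *)
Fixpoint lebesgue_tuple (R : realType) (d : nat) : set (d.-tuple R) -> \bar R :=
  match d return set (d.-tuple R) -> \bar R with
  | 0 => fun A => \d_([tuple] : 0.-tuple R) A
  | d'.+1 => fun A =>
      ((@lebesgue_measure R : set (measurableTypeR R) -> \bar R)
         \x (@lebesgue_tuple R d' : set (d'.-tuple (measurableTypeR R)) -> \bar R))%E
        [set p | A (cons_tuple p.1 p.2)]
  end.

Definition lebesgue_rV (R : realType) (d : nat) (A : set 'rV[R]_d) : \bar R :=
  lebesgue_tuple [set t : d.-tuple R | A (\row_(i < d) tnth t i)].

Definition natural_density (R : realType) (d : nat) (X : set 'rV[R]_d)
    (delta : R) : Prop :=
  (counting (X `&` cball2 rho) / lebesgue_rV (@cball2 R d rho))%E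
    @[rho --> +oo] --> delta%:E.

(* A modulus of continuity is a function on the open interval from 0 to
   [modulus_dom]; the values of [modulus_fun] outside it are irrelevant. *)
Record modulus (R : realType) := Modulus {
  modulus_dom : R ;
  modulus_fun :> R -> R ;
  modulus_dom_gt0 : 0 < modulus_dom ;
  modulus_fun_gt0 : forall t : R, 0 < t < modulus_dom -> 0 < modulus_fun t ;
  modulus_increasing : forall s t : R,
    0 < s < modulus_dom -> 0 < t < modulus_dom ->
    s < t -> modulus_fun s < modulus_fun t ;
  modulus_concave : forall l s t : R,
    0 <= l <= 1 -> 0 < s < modulus_dom -> 0 < t < modulus_dom ->
    l * modulus_fun s + (1 - l) * modulus_fun t
      <= modulus_fun (l * s + (1 - l) * t) ;
  modulus_cvg0 : modulus_fun t @[t --> 0^'+] --> (0 : R)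
}.

Definition homogeneous_mapping (R : realType) (d : nat) (omega : modulus R)
    (X Y : set 'rV[R]_d) (f : 'rV[R]_d -> 'rV[R]_d) : Prop :=
  set_fun X Y f /\
  exists K a : R, [/\ 0 < K, 0 < a < 1 &
    forall (rho : R) (x1 x2 : 'rV[R]_d), 0 < rho ->
      (X `&` oball2 rho) x1 -> (X `&` oball2 rho) x2 -> x1 != x2 ->
      norm2 (x2 - x1) < a * rho ->
      norm2 (x2 - x1) / rho < modulus_dom omega ->
      norm2 (f x2 - f x1) <= K * rho * omega (norm2 (x2 - x1) / rho)].

Definition regular_wrt (R : realType) (d : nat) (omega : modulus R)
    (X Y : set 'rV[R]_d) : Prop :=
  exists f g : 'rV[R]_d -> 'rV[R]_d,
    [/\ set_bij X Y f, forall x, X x -> g (f x) = x,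
        homogeneous_mapping omega X Y f & homogeneous_mapping omega Y X g].

Definition irregular_wrt (R : realType) (d : nat) (omega : modulus R)
    (X Y : set 'rV[R]_d) : Prop := ~ regular_wrt omega X Y.

Definition integer_lattice (R : realType) (d : nat) : set 'rV[R]_d :=
  [set x | forall i, x ord0 i \is a Num.int].

Definition irregular (R : realType) (d : nat) (omega : modulus R)
    (X : set 'rV[R]_d) : Prop := irregular_wrt omega X (@integer_lattice R d).

(* Main.v *)
From HB Require Import structures.
Require Import Defs.
From mathcomp Require Import all_boot all_order all_algebra.
From mathcomp Require Import all_classical all_reals all_analysis.
From mathcomp Require Import finmap measurable_realfun ring lra zify.
Import Order.TTheory GRing.Theory Num.Theory.
Import numFieldNormedType.Exports.
Local Open Scope classical_set_scope.
Local Open Scope ring_scope.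

(* The net is Z^d together with sparse families of extra points z + e_0 / 2.
   On large balls a homogeneous mapping for [omega t = t (log (1 / t))^alpha]
   is Lipschitz with a constant polylogarithmic in the radius, so it suffices to
   place, for every n, a finite pattern of size exp(poly(n)) which excludes
   bijections f onto Z^d that are n-Lipschitz together with their inverses.

   The pattern is a discrete version of the Burago-Kleiner construction.
   Consider a segment of direction e_0, stretched by f by a factor A, and the
   row of cubes along it, which alternately do and do not contain the extra
   points. If no shorter segment next to it is stretched by more than
   (1 + 1 / kappa) A, then all increments of f over one cube side are almost
   maximal in the direction of the stretched segment, so that for two
   consecutive cubes f (x + s e_0) - f x is almost a constant vector W. Then
   x |-> f^-1 (f x - W) maps the interior of the dense cube injectively into
   the sparse cube, and counting points gives a contradiction. Hence some
   shorter segment is stretched by (1 + 1 / kappa) A; as the pattern is nested,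
   this can be iterated until the stretch exceeds n. *)

Set Implicit Arguments.
Unset Strict Implicit.
Unset Printing Implicit Defensive.

(** * Bernoulli's inequalities *)

Lemma bernoulli_sub (R : realDomainType) (n : nat) (y : R) :
  0 <= y <= 1 -> 1 - n%:R * y <= (1 - y) ^+ n.
Proof.
move=> /andP[y0 y1]; elim: n => [|n IH]; first by rewrite mul0r subr0 expr0.
rewrite exprS; have y1' : 0 <= 1 - y by rewrite subr_ge0.
apply: le_trans (ler_wpM2l y1' IH).
have n0 : 0 <= n%:R :> R by [].
by rewrite -natr1; nra.
Qed.

Lemma bernoulli_add (R : realDomainType) (n : nat) (y : R) :
  0 <= y -> 1 + n%:R * y <= (1 + y) ^+ n.
Proof.
move=> y0; elim: n => [|n IH]; first by rewrite mul0r addr0 expr0.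
have y1 : 0 <= 1 + y by rewrite addr_ge0.
rewrite exprS; apply: le_trans (ler_wpM2l y1 IH).
have n0 : 0 <= n%:R :> R by [].
by rewrite -natr1; nra.
Qed.

(** * Euclidean norm *)

Section EuclideanNorm.
Variables (R : realType) (d : nat).
Implicit Types x y z : 'rV[R]_d.

Definition dotv x y : R := \sum_(i < d) x ord0 i * y ord0 i.

Lemma dotvC x y : dotv x y = dotv y x.
Proof. by apply: eq_bigr => i _; rewrite mulrC. Qed.

Lemma dotvDl x y z : dotv (x + y) z = dotv x z + dotv y z.
Proof. by rewrite -big_split; apply: eq_bigr => i _; rewrite mxE mulrDl. Qed.

Lemma dotvZl a x y : dotv (a *: x) y = a * dotv x y.
Proof. by rewrite big_distrr; apply: eq_bigr => i _; rewrite mxE /= mulrA. Qed.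

Lemma dotvNl x y : dotv (- x) y = - dotv x y.
Proof. by rewrite -scaleN1r dotvZl mulN1r. Qed.

Lemma dotvBl x y z : dotv (x - y) z = dotv x z - dotv y z.
Proof. by rewrite dotvDl dotvNl. Qed.

Lemma dotvBr x y z : dotv z (x - y) = dotv z x - dotv z y.
Proof. by rewrite dotvC dotvBl !(dotvC _ z). Qed.

Lemma dotvZr a x y : dotv y (a *: x) = a * dotv y x.
Proof. by rewrite dotvC dotvZl dotvC. Qed.

Lemma dotv_suml (n : nat) (F : nat -> 'rV[R]_d) y :
  dotv (\sum_(0 <= i < n) F i) y = \sum_(0 <= i < n) dotv (F i) y.
Proof.
elim: n => [|n IH]; last by rewrite !big_nat_recr//= dotvDl IH.
by rewrite !big_geq// /dotv big1// => i _; rewrite mxE mul0r.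
Qed.

Lemma norm2_ge0 x : 0 <= norm2 x. Proof. exact: sqrtr_ge0. Qed.

Lemma sqr_norm2 x : norm2 x ^+ 2 = dotv x x.
Proof.
rewrite sqr_sqrtr; last by apply: sumr_ge0 => i _; exact: sqr_ge0.
by apply: eq_bigr => i _; rewrite expr2.
Qed.

Lemma norm2Z a x : norm2 (a *: x) = `|a| * norm2 x.
Proof.
rewrite /norm2 -sqrtr_sqr -sqrtrM ?sqr_ge0// big_distrr; congr Num.sqrt.
by apply: eq_bigr => i _; rewrite mxE exprMn.
Qed.

Lemma norm2N x : norm2 (- x) = norm2 x.
Proof. by rewrite -scaleN1r norm2Z normrN normr1 mul1r. Qed.

Lemma norm2_0 : norm2 (0 : 'rV[R]_d) = 0.
Proof. by rewrite -(scale0r (0 : 'rV[R]_d)) norm2Z normr0 mul0r. Qed.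

Lemma norm2_distC x y : norm2 (x - y) = norm2 (y - x).
Proof. by rewrite -norm2N opprB. Qed.

Lemma ler_coord_norm2 x i : `|x ord0 i| <= norm2 x.
Proof.
rewrite -sqrtr_sqr ler_sqrt; last by apply: sumr_ge0 => j _; exact: sqr_ge0.
by rewrite (bigD1 i)//= lerDl sumr_ge0// => j _; exact: sqr_ge0.
Qed.

Lemma norm2_le_coord x (M : R) :
  0 <= M -> (forall i, `|x ord0 i| <= M) -> norm2 x <= d%:R * M.
Proof.
move=> M0 h; have dM0 : 0 <= d%:R * M by rewrite mulr_ge0.
rewrite -[leRHS]ger0_norm// -sqrtr_sqr ler_sqrt ?sqr_ge0//.
apply: (@le_trans _ _ (\sum_(i < d) M ^+ 2)).
  by apply: ler_sum => i _; rewrite -real_normK ?num_real// lerXn2r// nnegrE.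
rewrite sumr_const card_ord -[leLHS]mulr_natl exprMn.
apply: ler_pM; rewrite ?sqr_ge0 ?ler0n// -natrX ler_nat.
by case: (d) => // n; rewrite -mulnn leq_pmulr.
Qed.

Lemma dotv_le x y : dotv x y <= norm2 x * norm2 y.
Proof.
have [x0|x0] := eqVneq (norm2 x) 0.
  rewrite x0 mul0r /dotv big1// => i _.
  have := ler_coord_norm2 x i; rewrite x0 normr_le0 => /eqP ->.
  by rewrite mul0r.
have [y0|y0] := eqVneq (norm2 y) 0.
  rewrite y0 mulr0 /dotv big1// => i _.
  have := ler_coord_norm2 y i; rewrite y0 normr_le0 => /eqP ->.
  by rewrite mulr0.
have xy0 : 0 < norm2 x * norm2 y.
  by rewrite mulr_gt0// lt_neqAle eq_sym norm2_ge0 ?x0 ?y0.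
have : 0 <= dotv (norm2 y *: x - norm2 x *: y) (norm2 y *: x - norm2 x *: y).
  by rewrite -sqr_norm2 sqr_ge0.
rewrite !dotvBl !dotvBr !dotvZl !dotvZr -!sqr_norm2.
rewrite [dotv y x]dotvC => h.
rewrite -(ler_pM2l xy0).
move: h; set a := norm2 x; set b := norm2 y; set c := dotv x y.
nra.
Qed.

Lemma ler_norm2D x y : norm2 (x + y) <= norm2 x + norm2 y.
Proof.
rewrite -[leLHS]ger0_norm ?norm2_ge0// -[leRHS]ger0_norm ?addr_ge0 ?norm2_ge0//.
rewrite -!sqrtr_sqr ler_sqrt ?sqr_ge0// sqrrD !sqr_norm2.
rewrite dotvDl ![dotv _ (_ + _)]dotvC !dotvDl [dotv y x]dotvC.
by have := dotv_le x y; lra.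
Qed.

Lemma ler_norm2B x y : norm2 (x - y) <= norm2 x + norm2 y.
Proof. by rewrite -(norm2N y) ler_norm2D. Qed.

Lemma ler_norm2_distD z x y : norm2 (x - y) <= norm2 (x - z) + norm2 (z - y).
Proof. by rewrite (_ : x - y = (x - z) + (z - y)) ?ler_norm2D// addrA subrK. Qed.

End EuclideanNorm.

(** * Volume and lattice points *)

Section Volume.
Variable R : realType.
Local Notation RT := (measurableTypeR R).

Definition cube (d : nat) (a : d.-tuple R) (L : R) : set (d.-tuple R) :=
  [set t | forall i, tnth a i <= tnth t i < tnth a i + L].

Lemma measurable_cube (d : nat) (a : d.-tuple R) (L : R) :
  measurable (cube a L : set (d.-tuple RT)).
Proof.
have -> : cube a L = \bigcap_(i in [set: 'I_d])
    ((fun t : d.-tuple RT => tnth t i) @^-1` `[tnth a i, tnth a i + L[%classic).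
  apply/seteqP; split => [t h i _|t h i]; first by rewrite /= in_itv/=.
  by have := h i I; rewrite /= in_itv/=.
apply: (@fin_bigcap_measurable _ (d.-tuple RT)) => // i _.
rewrite -[X in measurable X]setTI; exact: (@measurable_tnth _ RT).
Qed.

(** The cubes from [- n] to [n] exhaust the space. The packaged structure is what forming the
    product with one more line requires. *)
Lemma sigma_finite_of_cube (d : nat)
    (mu : {measure set (d.-tuple RT) -> \bar R}) :
  (forall (a : d.-tuple R) (L : R), 0 <= L -> (mu (cube a L) < +oo)%E) ->
  exists mu' : {sigma_finite_measure set (d.-tuple RT) -> \bar R},
    mu = mu' :> (set (d.-tuple RT) -> \bar R).
Proof.
move=> fin; have sm : sigma_finite setT mu; last first.
  pose sf := isSFinite.Build _ _ _ _ (sfinite_measure_sigma_finite sm).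
  pose sm' := isSigmaFinite.Build _ _ _ _ sm.
  by exists (HB.pack_for {sigma_finite_measure set (d.-tuple RT) -> \bar R}
    (Measure.sort mu) sf sm').
exists (fun n => cube [tuple - n%:R | i < d] n.*2%:R).
  apply/esym; rewrite -subTset => t _.
  pose m := \sum_(i < d) `|tnth t i|.
  have m0 : 0 <= m by rewrite sumr_ge0.
  exists (Num.truncn m).+1 => // i; rewrite tnth_mktuple.
  have /andP[_ hm] := truncn_itv m0.
  have : `|tnth t i| <= m.
    by rewrite /m (bigD1 i)//= lerDl sumr_ge0.
  move=> /le_lt_trans/(_ hm); rewrite ltr_norml => /andP[h1 h2].
  by rewrite (ltW h1)/= -addnn natrD addKr.
move=> n; split; first exact: measurable_cube.
exact: fin.
Qed.

(** [lebesgue_tuple] is a bare set function. The induction exhibits it as the push-forward of a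
    product measure along [cons_tuple]; the volume of cubes makes it sigma-finite, so that the next
    product is again a measure. *)
Lemma lebesgue_tuple_measure (d : nat) :
  exists2 mu : {sigma_finite_measure set (d.-tuple RT) -> \bar R},
    @lebesgue_tuple R d = mu :> (set (d.-tuple RT) -> \bar R) &
    forall (a : d.-tuple R) (L : R), 0 <= L -> mu (cube a L) = (L ^+ d)%:E.
Proof.
suff [mu muE mucube] : exists2 mu : {measure set (d.-tuple RT) -> \bar R},
    @lebesgue_tuple R d = mu :> (set (d.-tuple RT) -> \bar R) &
    forall (a : d.-tuple R) (L : R), 0 <= L -> mu (cube a L) = (L ^+ d)%:E.
  have [a L L0|mu' mu'E] := @sigma_finite_of_cube _ mu.
    by rewrite mucube// ltry.
  by exists mu' => [|a L L0]; rewrite -?mu'E// mucube.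
elim: d => [|d [mu muE mucube]].
  exists (@dirac _ (0.-tuple RT) [tuple] R) => // a L L0.
  by rewrite /= /dirac indicE mem_set // => -[].
have [a L L0|mu' mu'E] := @sigma_finite_of_cube _ mu.
  by rewrite mucube// ltry.
pose leb : {sigma_finite_measure set RT -> \bar R} := @lebesgue_measure R.
pose nu : {measure set (RT * d.-tuple RT)%type -> \bar R} :=
  product_measure1 leb mu'.
pose phi (p : RT * d.-tuple RT) : d.+1.-tuple RT := cons_tuple p.1 p.2.
have mphi : measurable_fun setT phi by exact: measurable_cons.
exists (measure_function_pushforward__canonical__measure_function_Measure nu mphi).
  by rewrite /= /pushforward /nu /= -mu'E -muE.
move=> a L L0.
rewrite /= /pushforward.
have -> : phi @^-1` cube a L =
    `[thead a, thead a + L[%classic `*` cube [tuple of behead a] L.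
  apply/seteqP; split => [[x t] h|[x t] [/= hx ht]].
    split=> [|i].
      by have := h ord0; rewrite /= in_itv.
    have := h (lift ord0 i).
    by rewrite /phi /= !tnthS /=; rewrite [in X in X -> _](tuple_eta a) tnthS.
  move=> i; rewrite /phi /=.
  case: (unliftP ord0 i) => [j ->|->]; last by move: hx; rewrite in_itv.
  by rewrite !tnthS (tuple_eta a) tnthS; exact: ht.
rewrite [LHS](@product_measure1E _ _ _ _ _ leb mu') //; last first.
  exact: measurable_cube.
rewrite -mu'E mucube//; rewrite /leb /=.
rewrite lebesgue_measure_itv /=.
(* The length formula distinguishes [0 < L]; in the other case [L = 0] and both sides vanish. *)
case: ifPn => [_|]; first by rewrite EFinN -EFinD addrAC subrr add0r exprS EFinM.
rewrite lte_fin ltrDl -leNgt => L0'.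
have -> : L = 0 by apply/le_anti; rewrite L0' L0.
by rewrite exprS mul0r mul0e.
Qed.

(** Uniqueness of Lebesgue measure: [c] times the push-forward under multiplication by [c] gives
    every interval []a, b]] its length. *)
Lemma lebesgue_measure_scale (c : R) (A : set RT) : 0 < c -> measurable A ->
  lebesgue_measure A = (c%:E * lebesgue_measure [set x | A (c * x)%R])%E.
Proof.
move=> c0 mA; have cnng : 0 <= c by exact: ltW.
pose f (x : RT) : RT := c * x.
have mf : measurable_fun setT f by exact: measurable_funM.
pose pf : {measure set RT -> \bar R} :=
  measure_function_pushforward__canonical__measure_function_Measure
    (@lebesgue_measure R) mf.
pose m : {measure set RT -> \bar R} := mscale (NngNum cnng) pf.
apply: (@lebesgue_measure_unique R m) => // _ [[a b] _ <-].
rewrite /m /= /mscale /= /pf /= /pushforward.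
have -> : f @^-1` `]a, b] = `](a / c), (b / c)]%classic.
  apply/seteqP; split => x; rewrite /f /= !in_itv/= ltr_pdivrMr// ler_pdivlMr//;
    by rewrite mulrC.
rewrite !lebesgue_measure_itv /= !lte_fin ltr_pM2r ?invr_gt0//.
case: ifP => _; last by rewrite mule0.
by rewrite -!EFinD -EFinM -mulrBl mulrC divfK// gt_eqF.
Qed.

(** The rescaled measure agrees with the product measure on rectangles, by the case of the line in
    one factor and the induction hypothesis in the other; a measure with this property is unique. *)
Lemma lebesgue_tuple_scale (d : nat) (c : R) (A : set (d.-tuple RT)) :
  0 < c -> measurable A ->
  lebesgue_tuple A =
    ((c ^+ d)%:E * lebesgue_tuple [set t | A [tuple (c * tnth t i)%R | i < d]])%E.
Proof.
move=> c0; have cnng : 0 <= c by exact: ltW.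
elim: d A => [|d IH] A mA.
  rewrite expr0 mul1e /= /dirac; congr (\1__ _)%:E.
  exact/esym/tuple0.
have [mu muE mucube] := lebesgue_tuple_measure d.
pose leb : {sigma_finite_measure set RT -> \bar R} := @lebesgue_measure R.
pose nu : {measure set (RT * d.-tuple RT)%type -> \bar R} :=
  product_measure1 leb mu.
pose f (p : RT * d.-tuple RT) : RT * d.-tuple RT :=
  (c * p.1, [tuple c * tnth p.2 i | i < d]).
have mf : measurable_fun setT f.
  apply: measurable_fun_pair; first exact: measurable_funM.
  apply/measurable_fun_tnthP => i.
  rewrite (_ : _ \o _ = fun p => c * tnth p.2 i); last first.
    by apply/funext => p /=; rewrite tnth_mktuple.
  apply: measurable_funM => //.
  apply: (@measurableT_comp _ _ _ _ _ _ (fun x : d.-tuple RT => tnth x i)) => //.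
  exact: measurable_tnth.
pose pf : {measure set (RT * d.-tuple RT)%type -> \bar R} :=
  measure_function_pushforward__canonical__measure_function_Measure nu mf.
pose m : {measure set (RT * d.-tuple RT)%type -> \bar R} :=
  mscale (NngNum (exprn_ge0 d.+1 cnng)) pf.
pose phi (p : RT * d.-tuple RT) : d.+1.-tuple RT := cons_tuple p.1 p.2.
have mphi : measurable_fun setT phi by exact: measurable_cons.
transitivity (nu (phi @^-1` A)); first by rewrite /= muE.
rewrite /nu /= (@product_measure_unique _ _ _ _ _ leb mu m).
- rewrite /m /= /mscale /= muE; congr (_ * _)%E.
  rewrite /pf /= /pushforward /nu /=; congr product_measure1.
  apply/seteqP.
  suff E p : phi (f p) = [tuple c * tnth (cons_tuple p.1 p.2) i | i < d.+1].
    by split=> p; rewrite /= -/(phi (f p)) E.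
  apply: eq_from_tnth => i; rewrite tnth_mktuple /phi /f /=.
  by case: (unliftP ord0 i) => [j ->|->] //; rewrite !tnthS tnth_mktuple.
- move=> X Y mX mY; rewrite /m /= /mscale /= /pf /= /pushforward.
  have -> : f @^-1` (X `*` Y) = [set x | X (c * x)] `*`
     [set t | Y [tuple c * tnth t i | i < d]] by [].
  rewrite [nu _](@product_measure1E _ _ _ _ _ leb mu).
  + rewrite -muE (IH _ mY) muE /leb/= (lebesgue_measure_scale c0 mX) exprS EFinM.
    by rewrite muleACA.
  + rewrite -[X in measurable X]setTI.
    by have : measurable_fun [set: RT] (fun x : RT => c * x : RT);
      [exact: measurable_funM|exact].
  + have : measurable_fun [set: d.-tuple RT]
       (fun t : d.-tuple RT => [tuple c * tnth t i | i < d] : d.-tuple RT).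
      apply/measurable_fun_tnthP => i.
      rewrite (_ : _ \o _ = fun p => c * tnth p i); last first.
        by apply/funext => p /=; rewrite tnth_mktuple.
      by apply: measurable_funM => //; exact: measurable_tnth.
    by move=> /(_ measurableT _ mY); rewrite setTI.
- by rewrite -[X in measurable X]setTI; exact: mphi.
Qed.
End Volume.

(** * Cardinalities as extended reals *)

Section Counting.
Variables (R : realType) (T : choiceType).
Implicit Types A B : set T.
Local Notation counting := (@counting T R).

Lemma counting_finite A : finite_set A ->
  counting A = (#|` fset_set A|)%:R%:E.
Proof. by move=> fA; rewrite /counting_measure.counting asboolT. Qed.

Lemma le_counting A B : A `<=` B -> (counting A <= counting B)%E.
Proof.
move=> AB; have [fB|nB] := pselect (finite_set B); last first.
  by rewrite [X in (_ <= X)%E]/(counting_measure.counting _) asboolF// leey.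
have fA := sub_finite_set AB fB.
rewrite !counting_finite// lee_fin ler_nat fsubset_leq_card//.
by rewrite -fset_set_sub.
Qed.

Lemma counting_setU A B :
  (counting (A `|` B) <= counting A + counting B)%E.
Proof.
have [fA|nA] := pselect (finite_set A); last first.
  rewrite [X in (_ <= X + _)%E]/(counting_measure.counting _) asboolF//.
  rewrite addye ?leey//.
  by rewrite /counting_measure.counting; case: ifP.
have [fB|nB] := pselect (finite_set B); last first.
  rewrite [X in (_ <= _ + X)%E]/(counting_measure.counting _) asboolF//.
  rewrite addey ?leey//.
  by rewrite /counting_measure.counting; case: ifP.
rewrite !counting_finite//; last by rewrite finite_setU.
rewrite -EFinD lee_fin -natrD ler_nat fset_setU// cardfsU.
by rewrite leq_subr.
Qed.

Lemma counting_image_le (I : finType) (P : pred I) (f : I -> T) A :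
  (forall x, A x -> exists2 i, P i & f i = x) ->
  finite_set A /\ (counting A <= #|P|%:R%:E)%E.
Proof.
move=> h.
pose B : {fset T} := [fset f i | i in P]%fset.
have AB : A `<=` [set` B].
  by move=> x /h[i Pi <-]; apply/imfsetP; exists i.
have fA : finite_set A by apply: (sub_finite_set AB); exact: finite_fset.
split=> //; apply: le_trans (le_counting AB) _.
rewrite counting_finite; last exact: finite_fset.
rewrite set_fsetK lee_fin ler_nat; apply: leq_trans (leq_imfset_card _ _ _) _.
by rewrite cardE.
Qed.

End Counting.

(** * Lattice points in a ball compared with its volume *)

Section LatticeVolume.
Variables (R : realType) (d : nat).
Local Notation RT := (measurableTypeR R).
Local Notation Zd := (@integer_lattice R d).
Local Notation vol rho := (lebesgue_rV (@cball2 R d rho)).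

Lemma cball2E (rho : R) (x : 'rV[R]_d) : 0 <= rho ->
  cball2 rho x <-> \sum_(i < d) x ord0 i ^+ 2 <= rho ^+ 2.
Proof.
move=> r0; rewrite /cball2/= /norm2.
by rewrite -{1}(ger0_norm r0) -sqrtr_sqr ler_sqrt ?sqr_ge0.
Qed.

Lemma measurable_cball2 (rho : R) : 0 <= rho ->
  measurable ([set t | cball2 rho (\row_(i < d) tnth t i)] : set (d.-tuple RT)).
Proof.
move=> r0.
have -> : [set t : d.-tuple RT | cball2 rho (\row_(i < d) tnth t i)] =
    (fun t : d.-tuple RT => \sum_(i < d) tnth t i ^+ 2) @^-1`
      `]-oo, (rho ^+ 2)]%classic.
  apply/seteqP; split => t /=; rewrite in_itv/= => h.
    move/(cball2E _ r0): h; apply: le_trans.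
    by apply: ler_sum => i _; rewrite mxE.
  apply/(cball2E _ r0); apply: le_trans h.
  by apply: ler_sum => i _; rewrite mxE.
rewrite -[X in measurable X]setTI.
apply: (@measurable_sum _ (d.-tuple RT)) => // i.
apply: measurable_funX; exact: measurable_tnth.
Qed.

Lemma vol_scale (c rho : R) : 0 < c -> 0 <= rho ->
  vol (c * rho) = ((c ^+ d)%:E * vol rho)%E.
Proof.
move=> c0 r0; rewrite /lebesgue_rV.
have cr0 : 0 <= c * rho by rewrite mulr_ge0// ltW.
rewrite (lebesgue_tuple_scale c0 (measurable_cball2 cr0)); congr (_ * _)%E.
congr lebesgue_tuple; apply/funext => t; apply/propext => /=.
rewrite !cball2E//.
under eq_bigr do rewrite mxE tnth_mktuple exprMn.
rewrite -mulr_sumr exprMn ler_pM2l ?exprn_gt0//.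
by under [in X in _ <-> X]eq_bigr do rewrite mxE.
Qed.

(** Integer coordinates bounded by [m] in absolute value are encoded, after a shift by [m], in
    ['I_(m.*2.+1)]. *)
Lemma lattice_cball_finite (rho : R) : finite_set (Zd `&` cball2 rho).
Proof.
pose m := (Num.truncn rho).+1.
have [] // := @counting_image_le R 'rV[R]_d {ffun 'I_d -> 'I_(m.*2.+1)} predT
   (fun t => \row_i ((t i)%:R - m%:R)) (Zd `&` cball2 rho).
move=> x [zx bx].
have hx i : `|x ord0 i| < m%:R.
  apply: le_lt_trans (ler_coord_norm2 x i) _; apply: le_lt_trans bx _.
  exact: truncnS_gt.
have hm i : (Num.truncn (x ord0 i + m%:R))%:R = x ord0 i + m%:R.
  apply/eqP; rewrite -natrEtruncn -intrEge0 ?rpredD ?zx ?natr_int//.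
  by have := hx i; rewrite ltr_norml; lra.
exists [ffun i => inord (Num.truncn (x ord0 i + m%:R))] => //.
apply/rowP => i; rewrite mxE ffunE inordK.
  by rewrite hm addrK.
rewrite -(ltr_nat R) hm -natr1 -addnn natrD.
by have := hx i; rewrite ltr_norml; lra.
Qed.

(** Half-open, so that the cubes at the lattice points tile the space. *)
Definition unit_cube (z : 'rV[R]_d) : set (d.-tuple RT) :=
  cube [tuple z ord0 i | i < d] 1.

Lemma unit_cube_norm (z : 'rV[R]_d) (t : d.-tuple RT) :
  unit_cube z t -> norm2 (\row_(i < d) tnth t i - z) <= d%:R.
Proof.
move=> h; rewrite -[leRHS]mulr1; apply: norm2_le_coord => // i.
have := h i; rewrite tnth_mktuple !mxE => /andP[h1 h2].
by rewrite ger0_norm; lra.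
Qed.

Lemma unit_cube_trivIset : trivIset Zd unit_cube.
Proof.
apply/trivIsetP => x y zx zy xy; rewrite -subset0 => t [hx hy].
apply: (negP xy); apply/eqP/rowP => i.
have := zx i; have := zy i => /intrP[n yn] /intrP[m xm].
have := hx i; have := hy i; rewrite !tnth_mktuple xm yn => h1 h2.
congr (_%:~R).
have : (m%:~R : R) < (n + 1)%:~R by rewrite intrD; lra.
have : (n%:~R : R) < (m + 1)%:~R by rewrite intrD; lra.
by rewrite !ltr_int; lia.
Qed.

Lemma unit_cube_cover (t : d.-tuple RT) : exists2 z, Zd z & unit_cube z t.
Proof.
exists (\row_i (Num.floor (tnth t i))%:~R).
  by move=> i; rewrite mxE; apply/intrP; eexists.
move=> i; rewrite tnth_mktuple mxE.
by have := floor_itv (tnth t i); rewrite intrD.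
Qed.

Lemma lebesgue_unit_cubes (A : set 'rV[R]_d) : finite_set A -> A `<=` Zd ->
  lebesgue_tuple (\bigcup_(z in A) unit_cube z) = counting A.
Proof.
move=> fA AZ; have [mu muE mucube] := lebesgue_tuple_measure R d.
rewrite muE measure_fin_bigcup//; last first.
- by move=> z _; exact: measurable_cube.
- by apply: sub_trivIset unit_cube_trivIset.
rewrite counting_finite// fsbig_finite//=.
rewrite (eq_bigr (fun=> (1%:E : \bar R))) => [|z _]; last first.
  by rewrite /unit_cube mucube// expr1n.
by rewrite sumEFin big_const_seq count_predT iter_addr_0.
Qed.

(** The disjoint unit cubes at these lattice points all lie in the larger ball, [d] being a crude
    bound for the distance to the corner of a cube. *)
Lemma counting_lattice_le (rho : R) : 0 <= rho ->
  (counting (Zd `&` cball2 rho) <= vol (rho + d%:R))%E.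
Proof.
move=> r0; have r1 : 0 <= rho + d%:R by rewrite addr_ge0.
rewrite -lebesgue_unit_cubes; [|exact: lattice_cball_finite|by move=> ? []].
have [mu muE mucube] := lebesgue_tuple_measure R d.
rewrite /lebesgue_rV muE; apply: le_measure; try apply/mem_set.
- apply: (@fin_bigcup_measurable _ (d.-tuple RT)); first exact: lattice_cball_finite.
  by move=> z _; exact: measurable_cube.
- exact: measurable_cball2.
move=> t [z [_ bz] tz] /=; rewrite /cball2/=.
rewrite -[X in norm2 X](subrK z); apply: le_trans (ler_norm2D _ _) _.
by rewrite addrC lerD//; exact: unit_cube_norm.
Qed.

(** Conversely, the unit cubes that meet the ball have their corners in the ball of radius
    [rho + d]. *)
Lemma counting_lattice_ge (rho : R) : 0 <= rho ->
  (vol rho <= counting (Zd `&` cball2 (rho + d%:R)))%E.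
Proof.
move=> r0.
rewrite -lebesgue_unit_cubes; [|exact: lattice_cball_finite|by move=> ? []].
have [mu muE mucube] := lebesgue_tuple_measure R d.
rewrite /lebesgue_rV muE; apply: le_measure; try apply/mem_set.
- exact: measurable_cball2.
- apply: (@fin_bigcup_measurable _ (d.-tuple RT)); first exact: lattice_cball_finite.
  by move=> z _; exact: measurable_cube.
move=> t bt; have [z Zz tz] := unit_cube_cover t.
exists z => //; split=> //; rewrite /cball2/=.
rewrite -(subKr (\row_i tnth t i) z); apply: le_trans (ler_norm2B _ _) _.
by rewrite lerD//; exact: unit_cube_norm.
Qed.

End LatticeVolume.

(** * Natural density of the lattice with a sparse set added *)

Section DensityOne.
Variables (R : realType) (d : nat).
Local Notation Zd := (@integer_lattice R d).
Local Notation vol rho := (lebesgue_rV (@cball2 R d rho)).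

(** Scaling leaves only the unit ball. Comparison with lattice points shows that its volume is
    finite, and positive because the origin is a lattice point. *)
Lemma vol_cball2 : exists2 v : R, 0 < v &
  forall rho : R, 0 < rho -> vol rho = (rho ^+ d * v)%:E.
Proof.
have vE (rho : R) : 0 < rho -> vol rho = ((rho ^+ d)%:E * vol 1)%E.
  by move=> r0; rewrite -{1}(mulr1 rho) vol_scale.
have v1lt : (vol 1 < +oo)%E.
  apply: le_lt_trans (counting_lattice_ge _ _) _ => //.
  by rewrite counting_finite ?ltry//; exact: lattice_cball_finite.
have vgt : (0 < vol (1 + d%:R))%E.
  apply: lt_le_trans (counting_lattice_le _ _) => //.
  rewrite counting_finite ?lte_fin ?ltr0n; last exact: lattice_cball_finite.
  rewrite cardfs_gt0; apply/fset0Pn; exists 0.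
  rewrite in_fset_set; last exact: lattice_cball_finite.
  apply/mem_set; split; first by move=> i; rewrite mxE rpred0.
  by rewrite /cball2/= norm2_0.
have d0 : (0 : R) < 1 + d%:R by rewrite ltr_wpDr.
move: vgt; rewrite vE// => vgt.
have v1gt : (0 < vol 1)%E.
  by move: vgt; rewrite pmule_rgt0// lte_fin exprn_gt0.
have v1fin : vol 1 \is a fin_num by rewrite ge0_fin_numE// ltW.
exists (fine (vol 1)); first by rewrite -lte_fin fineK.
by move=> rho r0; rewrite vE// EFinM fineK.
Qed.

(** The hypothesis says that [E] has density zero, so the lattice decides; its points in the ball
    are counted by the volumes of the balls of radii [rho - d] and [rho + d]. *)
Lemma natural_density_lattice_setU (E : set 'rV[R]_d) :
  (forall eps : R, 0 < eps -> exists rho0 : R, forall rho, rho0 <= rho ->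
     (counting (E `&` cball2 rho) <= (eps * rho ^+ d)%:E)%E) ->
  natural_density (Zd `|` E) 1.
Proof.
move=> hE; have [v v0 vE] := vol_cball2.
have Xle rho : (@counting _ R ((Zd `|` E) `&` cball2 rho) <=
    counting (Zd `&` cball2 rho) + counting (E `&` cball2 rho))%E.
  by rewrite setIUl; exact: counting_setU.
have cge0 (A : set 'rV[R]_d) : (0%:E <= @counting _ R A)%E.
  by rewrite /counting_measure.counting; case: ifP => _; rewrite ?lee_fin ?leey.
have [rho1 hrho1] := hE 1 ltr01.
have bound (rho : R) : 0 < rho -> rho1 <= rho -> exists c : R,
   counting ((Zd `|` E) `&` cball2 rho) = c%:E.
  move=> r0 r1; exists (fine (@counting _ R ((Zd `|` E) `&` cball2 rho))).
  rewrite fineK// ge0_fin_numE ?cge0//.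
  apply: le_lt_trans (Xle _) _.
  have := leeD (counting_lattice_le d (ltW r0)) (hrho1 _ r1).
  by move=> /le_lt_trans; apply; rewrite vE ?ltry// ltr_wpDr.
have key (eps : R) : 0 < eps -> exists rho0 : R, forall rho, rho0 <= rho ->
  exists2 c : R, (counting ((Zd `|` E) `&` cball2 rho) / vol rho)%E = c%:E &
    `|1 - c| <= eps.
  move=> e0.
  have [rho0 hrho0] := hE (v * eps / 2) (divr_gt0 (mulr_gt0 v0 e0) (ltr0Sn R 1)).
  (* With [y = d / rho], this threshold makes [d * y] at most [eps / 4] and at most [1 / 4], as the
     Bernoulli bounds below require. *)
  pose M : R := d%:R ^+ 2 * (4 / eps + 4) + d%:R + 1.
  exists (Num.max (Num.max rho0 rho1) M) => rho.
  rewrite !ge_max -andbA => /and3P[r0 r1 rM].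
  have d0 : 0 <= d%:R :> R by [].
  have ei0 : 0 < 4 / eps + 4 by rewrite addr_gt0// divr_gt0.
  have dM : d%:R < M by rewrite /M; nra.
  have M0 : 0 < M by exact: le_lt_trans dM.
  have rho_gt0 : 0 < rho by exact: lt_le_trans rM.
  have [c cE] := bound _ rho_gt0 r1.
  exists (c / (rho ^+ d * v)).
    rewrite cE vE// inver ifF -?EFinM//.
    by apply/negbTE; rewrite mulf_neq0 ?gt_eqF// exprn_gt0.
  pose y := d%:R / rho.
  have y0 : 0 <= y by rewrite divr_ge0// ltW.
  have y1 : y <= 1 by rewrite /y ler_pdivrMr// mul1r (le_trans (ltW dM)).
  have dy : d%:R * y * (4 / eps + 4) <= 1.
    rewrite /y mulrA -expr2 mulrAC ler_pdivrMr// mul1r (le_trans _ rM)//.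
    by rewrite /M -addrA ler_wpDr// addr_ge0.
  have dy0 : 0 <= d%:R * y by rewrite mulr_ge0.
  have dye : d%:R * y <= eps / 4.
    have q4 : 4 / eps * eps = 4 by rewrite divfK// gt_eqF.
    rewrite ler_pdivlMr//; apply: le_trans (_ : d%:R * y * (4 / eps + 4) * eps <= _).
      rewrite -mulrA mulrDl q4 mulrDr lerDl; apply: mulr_ge0 => //.
      by rewrite mulr_ge0// (ltW e0).
    by rewrite -[leRHS]mul1r ler_wpM2r// ltW.
  have dyq : d%:R * y <= 1 / 4.
    rewrite ler_pdivlMr//; apply: le_trans dy.
    by rewrite ler_wpM2l// lerDr divr_ge0// (ltW e0).
  have by_ := @bernoulli_sub R d y.
  have {}by_ : 1 - d%:R * y <= (1 - y) ^+ d by apply: by_; rewrite y0 y1.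
  (* The upper bound for [(1 + y) ^+ d] comes from [(1 - y ^+ 2) ^+ d <= 1]. *)
  have Y1 : (1 + y) ^+ d * (1 - d%:R * y) <= 1.
    apply: (@le_trans _ _ ((1 + y) ^+ d * (1 - y) ^+ d)).
      by rewrite ler_wpM2l// exprn_ge0// addr_ge0.
    rewrite -exprMn exprn_ile1//; first by nra.
    by nra.
  have Y2 : (1 + y) ^+ d <= 1 + eps / 2.
    have P0 : 0 <= (1 + y) ^+ d by rewrite exprn_ge0// addr_ge0.
    by move: Y1 P0; set P := (_ ^+ d); nra.
  have rd0 : 0 < rho ^+ d by rewrite exprn_gt0.
  have lo : (rho - d%:R) ^+ d * v <= c.
    have rd : 0 < rho - d%:R by rewrite subr_gt0 (lt_le_trans dM).
    rewrite -lee_fin -cE -vE//.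
    apply: le_trans (counting_lattice_ge _ (ltW rd)) _; rewrite subrK.
    by apply: le_counting; exact: setSI.
  have hi : c <= (rho + d%:R) ^+ d * v + (v * eps / 2) * rho ^+ d.
    rewrite -lee_fin -cE EFinD -vE; last by rewrite ltr_wpDr.
    apply: le_trans (Xle _) _; apply: leeD; last exact: hrho0.
    by apply: counting_lattice_le; exact: ltW.
  have yE : y * rho = d%:R by rewrite /y divfK// gt_eqF.
  rewrite distrC ler_norml; apply/andP; split.
    rewrite lerBrDl ler_pdivlMr ?mulr_gt0//; apply: le_trans lo.
    have -> : rho - d%:R = (1 - y) * rho by rewrite mulrBl mul1r yE.
    rewrite exprMn -mulrA ler_pM2r ?mulr_gt0//.
    by apply: le_trans by_; lra.
  rewrite lerBlDr ler_pdivrMr ?mulr_gt0//; apply: le_trans hi _.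
  have -> : rho + d%:R = (1 + y) * rho by rewrite mulrDl mul1r yE.
  rewrite exprMn.
  have -> : (1 + y) ^+ d * rho ^+ d * v + v * eps / 2 * rho ^+ d =
      ((1 + y) ^+ d + eps / 2) * (rho ^+ d * v) by ring.
  by rewrite ler_pM2r ?mulr_gt0//; lra.
apply/fine_cvgP; split.
  have [rho0 h] := key 1 ltr01; near=> rho.
  by have [|c ->] := h rho; first by near: rho; apply: nbhs_pinfty_ge; exact: num_real.
apply/cvgrPdist_le => eps e0.
have [rho0 h] := key eps e0; near=> rho.
by have [|c /= ->] := h rho; first by near: rho; apply: nbhs_pinfty_ge; exact: num_real.
Unshelve. all: by end_near. Qed.

End DensityOne.

(** * Nearly extremal polygonal lines *)

Lemma exists_le_mean (R : realFieldType) (m : nat) (x : nat -> R) (S : R) :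
  (0 < m)%N -> \sum_(0 <= i < m) x i <= S ->
  exists2 i, (i < m)%N & x i <= S / m%:R.
Proof.
move=> m0 hS; apply: contrapT => h.
have h' i : (0 <= i < m)%N -> S / m%:R < x i.
  by move=> /andP[_ im]; rewrite ltNge; apply/negP => xi; apply: h; exists i.
have : \sum_(0 <= i < m) (S / m%:R) < \sum_(0 <= i < m) x i.
  by apply: ltr_sum_nat.
rewrite big_const_nat iter_addr_0 subn0 -(mulr_natr (S / _)) divfK; last first.
  by rewrite pnatr_eq0 -lt0n.
by rewrite ltNge hS.
Qed.

Lemma ler_sum_even (R : numDomainType) (m : nat) (x : nat -> R) :
  (forall i, (i < m.*2)%N -> 0 <= x i) ->
  \sum_(0 <= i < m) x i.*2 <= \sum_(0 <= i < m.*2) x i.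
Proof.
elim: m => [|m IH] h; first by rewrite !big_geq.
rewrite doubleS !big_nat_recr//= -addrA lerD//.
  by apply: IH => i im; apply: h; rewrite doubleS ltnS ltnW// ltnS ltnW.
by rewrite lerDl h// doubleS.
Qed.

Section Alignment.
Variables (R : realType) (d : nat) (J : finType) (m : nat).
Variables (F : J -> nat -> 'rV[R]_d) (P0 P1 : 'rV[R]_d) (L B e : R).
Hypotheses (m_gt0 : (0 < m)%N) (L_gt0 : 0 < L) (B_ge0 : 0 <= B).
Hypothesis P01 : L <= norm2 (P1 - P0).
Hypothesis F0 : forall a, norm2 (F a 0%N - P0) <= e.
Hypothesis F1 : forall a, norm2 (F a m.*2 - P1) <= e.
Hypothesis FB : forall a i, (i < m.*2)%N -> norm2 (F a i.+1 - F a i) <= B.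

(* The increments along each polygonal line have length at most [B] but add up
   to almost the maximal possible total in the direction [u]. Hence, on
   average, they are all close to the vector [B *: u]. *)
Lemma aligned_increments :
  exists2 i, (i < m)%N & forall a a',
    norm2 ((F a i.*2.+1 - F a i.*2) - (F a' i.*2.+1 - F a' i.*2)) <=
    2 * Num.sqrt (2 * B * (#|J|%:R * (m.*2%:R * B - L + 2 * e) / m%:R)).
Proof.
have p0 : 0 < norm2 (P1 - P0) by exact: lt_le_trans P01.
have [u u1 Pu] : exists2 u, norm2 u = 1 & dotv (P1 - P0) u = norm2 (P1 - P0).
  exists ((norm2 (P1 - P0))^-1 *: (P1 - P0)).
    by rewrite norm2Z ger0_norm ?invr_ge0 ?norm2_ge0// mulVf// gt_eqF.
  by rewrite dotvZr -sqr_norm2 expr2 mulKf// gt_eqF.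
have dotu x : dotv x u <= norm2 x by rewrite (le_trans (dotv_le _ _))// u1 mulr1.
pose v a i := F a i.+1 - F a i.
pose D a i := B - dotv (v a i) u.
have D0 a i : (i < m.*2)%N -> 0 <= D a i.
  by move=> im; rewrite subr_ge0 (le_trans (dotu _))// FB.
(* The deficits [D] telescope against the displacement of the endpoints; replacing these by [P0] and
   [P1] costs [2 * e]. *)
have Dsum a : \sum_(0 <= i < m.*2) D a i <= m.*2%:R * B - L + 2 * e.
  rewrite /D sumrB big_const_nat iter_addr_0 subn0 -mulr_natl.
  rewrite -dotv_suml telescope_sumr//.
  have -> : F a m.*2 - F a 0%N = (P1 - P0) - ((F a 0%N - P0) - (F a m.*2 - P1)).
    by apply/rowP => j; rewrite !mxE; ring.
  rewrite dotvBl Pu.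
  have := dotu (F a 0%N - P0 - (F a m.*2 - P1)).
  have := ler_norm2B (F a 0%N - P0) (F a m.*2 - P1).
  by have := F0 a; have := F1 a; move: P01; lra.
pose C := m.*2%:R * B - L + 2 * e.
(* Only even indices are averaged, since the step sought has to lead from an even cube to the next
   odd one. *)
have : \sum_(0 <= i < m) \sum_a D a i.*2 <= #|J|%:R * C.
  rewrite exchange_big/= mulr_natl -sumr_const; apply: ler_sum => a _.
  by apply: le_trans (Dsum a); apply: ler_sum_even => i; exact: D0.
move=> /(exists_le_mean m_gt0)[i im hi].
exists i => //.
have i2m : (i.*2 < m.*2)%N by rewrite ltn_double.
(* Expand [|v - B u|^2 = |v|^2 - 2 B <v, u> + B^2]; this is at most [2 * B * D] because
   [|v| <= B]. *)
have close a : norm2 (v a i.*2 - B *: u) <= Num.sqrt (2 * B * (#|J|%:R * C / m%:R)).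
  rewrite -[leLHS]ger0_norm ?norm2_ge0// -sqrtr_sqr ler_sqrt; last first.
    apply: mulr_ge0; first by rewrite mulr_ge0.
    by apply: le_trans hi; apply: sumr_ge0 => b _; exact: D0.
  rewrite sqr_norm2 dotvBl !(dotvBr _ (B *: u)) !dotvZl !dotvZr -!sqr_norm2 u1.
  rewrite (dotvC u).
  have Dai : D a i.*2 <= #|J|%:R * C / m%:R.
    apply: le_trans hi; rewrite (bigD1 a)//= lerDl; apply: sumr_ge0 => b _.
    exact: D0.
  have vB : norm2 (v a i.*2) <= B by exact: FB.
  have vB2 : norm2 (v a i.*2) ^+ 2 <= B ^+ 2.
    by rewrite lerXn2r// nnegrE ?norm2_ge0.
  apply: (@le_trans _ _ (2 * B * D a i.*2)); last by rewrite ler_wpM2l// mulr_ge0.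
  by rewrite /D; move: vB2; set w := dotv _ _; nra.
move=> a a'; apply: le_trans (ler_norm2_distD (B *: u) _ _) _.
rewrite [X in _ + X <= _]norm2_distC mulr2n mulrDl mul1r.
by apply: lerD; exact: close.
Qed.

End Alignment.

(** * Nested stripes *)

Section FiniteCounting.
Local Open Scope nat_scope.

Lemma sum_ltn_minn (M L : nat) : \sum_(0 <= y < M) (y < L) = minn M L.
Proof.
elim: M => [|M IH]; first by rewrite big_geq// min0n.
by rewrite big_nat_recr//= IH; case: ltnP; lia.
Qed.

Lemma card_ordE (s : nat) (P : pred nat) :
  #|[pred x : 'I_s | P x]| = \sum_(0 <= x < s) P x.
Proof.
rewrite -sum1_card big_mkcond big_mkord; apply: eq_bigr => x _.
by rewrite inE; case: (P x).
Qed.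

Lemma card_modn_lt (M L c : nat) :
  #|[pred x : 'I_(M * c) | x %% M < L]| <= c * L.
Proof.
rewrite (card_ordE (M * c) (fun x => x %% M < L)).
elim: c => [|c IH]; first by rewrite muln0 big_geq.
rewrite mulnS addnC (@big_cat_nat _ _ _ (M * c))//= ?leq_addr// mulSn addnC.
apply: leq_add => //.
rewrite -{1}[M * c]add0n big_addn addnC addnK.
rewrite (eq_big_nat _ _ (F2 := fun y => (y < L) : nat)).
  by rewrite sum_ltn_minn geq_minr.
by move=> y /andP[_ yM]; rewrite addnC mulnC modnMDl modn_small.
Qed.

Lemma card_ord_between (s m : nat) : m.*2 <= s ->
  #|[pred x : 'I_s | m <= x < s - m]| = s - m.*2.
Proof.
move=> ms; rewrite (card_ordE s (fun x => m <= x < s - m)).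
rewrite (@big_cat_nat _ _ _ m)//=; last by lia.
rewrite big_nat big1 ?add0n; last by move=> x /andP[_]; case: leqP.
rewrite (@big_cat_nat _ _ _ (s - m))//=; [|lia|lia].
rewrite [X in _ + X]big_nat [X in _ + X]big1 ?addn0; last first.
  by move=> x /andP[h _]; rewrite [_ < _ - _]ltnNge h andbF.
rewrite big_nat (eq_bigr (fun=> 1)); last by move=> x ->.
by rewrite -big_nat big_const_nat iter_addn_0; lia.
Qed.

Lemma card_family_prod (d : nat) (T : finType) (F : 'I_d -> pred T) :
  #|family F| = \prod_i #|F i|.
Proof. by rewrite card_family foldrE big_map big_enum. Qed.

Lemma card_ffun_coord (d s : nat) (i1 : 'I_d) (P : pred 'I_s) (k : nat) :
  #|P| * k <= s -> #|[pred t : {ffun 'I_d -> 'I_s} | P (t i1)]| * k <= s ^ d.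
Proof.
move=> hP; pose F i : pred 'I_s := if i == i1 then P else predT.
rewrite (eq_card (B := family F)); last first.
  move=> t; rewrite !inE; apply/idP/familyP => [h i|/(_ i1)].
    by rewrite /F; case: eqP => // ->.
  by rewrite /F eqxx.
rewrite card_family_prod (bigD1 i1)//= {1}/F eqxx mulnAC.
have -> : s ^ d = s * \prod_(i < d | i != i1) #|F i|.
  rewrite (eq_bigr (fun=> s)); last first.
    by move=> i /negbTE ii1; rewrite /F ii1 card_ord.
  by rewrite -[RHS](bigD1 i1 (P := predT) (F := fun=> s))//= prod_nat_const card_ord.
by rewrite leq_mul2r hP orbT.
Qed.

(** In the application a pair is a point of the net: [false] marks the lattice point [t], and [true]
    the extra point next to it, present only when [B t]. *)
Lemma card_prod_bool (V : finType) (A B : pred V) :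
  #|[pred x : V * bool | A x.1 && (x.2 ==> B x.1)]| = #|A| + #|[predI A & B]|.
Proof.
rewrite -!sum1_card -(pair_big_dep A (fun t b => b ==> B t) (fun _ _ => 1))/=.
rewrite [X in _ = _ + X](eq_bigl (fun t => A t && B t)) //.
rewrite big_mkcondr -big_split/=; apply: eq_bigr => t _.
by rewrite big_mkcond big_bool/= addnC; case: (B t).
Qed.

(** The margin [s / (8 d)] on each side leaves the proportion [1 - 1 / (4 d)] of every coordinate,
    and the [d]-th power of this is at least [3 / 4] by Bernoulli's inequality. *)
Lemma card_deep (d s m : nat) : s = 8 * d * m ->
  3 * s ^ d <=
    4 * #|[pred t : {ffun 'I_d -> 'I_s} | [forall i, m <= t i < s - m]]|.
Proof.
move=> sE.
have [->|d0] := posnP d.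
  rewrite (eq_card (B := predT)); first by rewrite card_ffun !card_ord.
  by move=> t; rewrite !inE; apply/forallP => -[].
rewrite (eq_card (B := family (fun=> [pred x : 'I_s | m <= x < s - m]))); last first.
  by move=> t; rewrite [LHS]inE; apply/forallP/familyP.
rewrite card_family_prod prod_nat_const card_ord card_ord_between; last by nia.
rewrite -(ler_nat rat) !natrM !natrX.
have -> : ((s - m.*2)%:R = s%:R * (1 - (4 * d%:R)^-1) :> rat)%R.
  rewrite natrB; last by nia.
  have -> : (s%:R = 8 * d%:R * m%:R :> rat)%R by rewrite sE !natrM.
  rewrite -muln2 natrM; field.
  by rewrite pnatr_eq0 -lt0n.
rewrite exprMn mulrCA mulrC; apply: ler_wpM2l; first by rewrite exprn_ge0.
have d1 : (0 < (4 * d%:R : rat)^-1 <= 1)%R.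
  rewrite invr_gt0 mulr_gt0 ?ltr0n// invf_le1 ?mulr_gt0 ?ltr0n//.
  by rewrite -natrM ler1n; lia.
have := @bernoulli_sub rat d (4 * d%:R)^-1.
rewrite (ltW (andP d1).1) (andP d1).2 => /(_ isT).
have -> : (d%:R * (4 * d%:R)^-1 = 4^-1 :> rat)%R.
  by rewrite invfM mulrCA mulfV ?mulr1// pnatr_eq0 -lt0n.
by lra.
Qed.

End FiniteCounting.

Lemma leq_card_exists (I V : finType) (P : I -> pred V) :
  (#|[pred t | [exists i, P i t]]| <= \sum_i #|P i|)%N.
Proof.
rewrite -sum1_card big_mkcond/=.
rewrite (eq_bigr (fun i => \sum_t (P i t : nat)%N)); last first.
  move=> i _; rewrite -sum1_card big_mkcond/=; apply: eq_bigr => t _.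
  by rewrite /in_mem/=; case: (P i t).
rewrite exchange_big/=; apply: leq_sum => t _.
rewrite inE; case: existsP => // -[i Pit].
by rewrite (bigD1 i)//= Pit.
Qed.

Lemma ord_dim_gt0 (d : nat) (i : 'I_d) : (0 < d)%N.
Proof. by case: d i => // -[]. Qed.

Section Pattern.
Variables (d : nat) (i0 i1 : 'I_d) (q N' T : nat).
Local Open Scope nat_scope.

(** Cubes of scale [j] have side [side j], and segments of that length start on a grid of mesh
    [spacing j], which is [side j / q]. Since [spacing j.+1 = N' * side j], the mesh one scale up is
    also the period of the slabs of thickness [side j]; hence the row of cubes along a segment of
    scale [j.+1] lies in a slab of scale [j]. *)
Definition side (j : nat) : nat := (q * N') ^ j.+1.
Definition spacing (j : nat) : nat := N' * (q * N') ^ j.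

Definition slab (j : nat) (w : 'I_d -> nat) : bool :=
  w i1 %% spacing j.+1 < side j.

(* Slabs of different scales overlap. The finest one decides, since finer slabs
   fill only a small part of a cube. *)
Definition stripes (w : 'I_d -> nat) : bool :=
  [exists j : 'I_T, [&& slab j w, [forall j' : 'I_T, (j' < j) ==> ~~ slab j' w]
                      & odd (w i0 %/ side j)]].

(** The point at offset [t] in the [k]-th cube of the row that issues from [p] in direction [i0]. *)
Definition cube_pt (j k : nat) (p t : 'I_d -> nat) : 'I_d -> nat :=
  fun i => p i + (i == i0) * (k * side j) + t i.

(** Offsets at which a smaller scale takes precedence; they form an error set of small
    proportion. *)
Definition finer (j : nat) (t : 'I_d -> nat) : bool :=
  [exists j' : 'I_T, (j' < j) && slab j' t].

Hypotheses (i01 : i0 != i1) (q_gt0 : 0 < q) (N'_gt0 : 0 < N').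
Hypothesis N'_even : ~~ odd N'.

Lemma side_gt0 j : 0 < side j.
Proof. by rewrite expn_gt0 muln_gt0 q_gt0 N'_gt0. Qed.

Lemma spacing_gt0 j : 0 < spacing j.
Proof. by rewrite muln_gt0 N'_gt0 expn_gt0 muln_gt0 q_gt0 N'_gt0. Qed.

Lemma spacingS j : spacing j.+1 = N' * side j. Proof. by []. Qed.

Lemma sideE j : side j = q * spacing j.
Proof. by rewrite /side /spacing mulnA expnS. Qed.

Lemma dvdn_spacing j j' : j <= j' -> spacing j %| spacing j'.
Proof. by move=> jj'; rewrite dvdn_mul// dvdn_exp2l. Qed.

Lemma slab_dvd j (p t : 'I_d -> nat) k l : spacing j.+1 %| p i1 ->
  slab j (cube_pt k l p t) = slab j t.
Proof.
move=> /dvdnP[c pE]; rewrite /slab /cube_pt (negbTE (contraNneq _ i01)); last first.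
  by move=> <-.
by rewrite mul0n addn0 pE modnMDl.
Qed.

(** The row runs inside a slab of scale [j], which decides wherever no finer slab intervenes. As
    [p i0] is a multiple of [N' * side j] with [N'] even, the parity of the stripe depends on [k]
    alone. *)
Lemma stripes_cube_pt (j k : nat) (p t : 'I_d -> nat) : j < T ->
  spacing j.+1 %| p i0 -> spacing j.+1 %| p i1 -> (forall i, t i < side j) ->
  ~~ finer j t -> stripes (cube_pt j k p t) = odd k.
Proof.
move=> jT p0 p1 tl fin.
have slabj' (j' : nat) : j' <= j ->
    slab j' (cube_pt j k p t) = slab j' t.
  by move=> jj'; apply: slab_dvd; apply: dvdn_trans p1; exact: dvdn_spacing.
have slabj : slab j t.
  by rewrite /slab; apply: leq_ltn_trans (tl i1); exact: leq_mod.
have oddE : odd (cube_pt j k p t i0 %/ side j) = odd k.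
  rewrite /cube_pt eqxx mul1n; case/dvdnP: p0 => c ->; rewrite spacingS mulnA.
  rewrite -mulnDl divnMDl ?side_gt0//.
  by rewrite divn_small// addn0 oddD oddM (negbTE N'_even) andbF.
apply/existsP/idP => [[l /and3P[sl /forallP fl ol]]|ok].
  have [lj|jl|lj] := ltngtP l j.
  - case/negP: fin; apply/existsP; exists l; rewrite lj/=.
    by rewrite -slabj' // ltnW.
  - have := fl (Ordinal jT); rewrite /= jl/= slabj'//.
    by rewrite slabj.
  - by move: ol; rewrite lj oddE.
exists (Ordinal jT); rewrite /= slabj'// slabj oddE ok andbT/=.
apply/forallP => l; apply/implyP => lj; rewrite slabj' 1?ltnW//.
by apply: contra fin => sl; apply/existsP; exists l; rewrite lj.
Qed.

(** [side j] is a multiple of the period [spacing j'.+1], and in each period the slab fills the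
    fraction [1 / N']. *)
Lemma card_slab (j j' : nat) : j' < j ->
  #|[pred t : {ffun 'I_d -> 'I_(side j)} | slab j' (fun i => t i)]| * N'
    <= side j ^ d.
Proof.
move=> jj'; pose c := q * (q * N') ^ (j - j'.+1).
have lE : side j = spacing j'.+1 * c.
  rewrite /c /spacing mulnACA -expnD [N' * q]mulnC -expnS /side.
  by congr (_ ^ _); lia.
apply: (@card_ffun_coord d (side j) i1
  [pred x : 'I_(side j) | x %% spacing j'.+1 < side j']).
apply: (@leq_trans (c * side j' * N')).
  rewrite leq_mul2r; apply/orP; right.
  by move: (lE) => ->; exact: card_modn_lt.
by rewrite lE spacingS; nia.
Qed.

Lemma card_finer (j : nat) :
  #|[pred t : {ffun 'I_d -> 'I_(side j)} | finer j (fun i => t i)]| * N'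
    <= T * side j ^ d.
Proof.
apply: leq_trans (_ : (\sum_(j' < T) #|[pred t : {ffun 'I_d -> 'I_(side j)} |
   (j' < j) && slab j' (fun i => t i)]|) * N' <= _).
  by rewrite leq_mul2r; apply/orP; right; exact: leq_card_exists.
rewrite big_distrl/= -[X in _ <= X * _]card_ord -sum_nat_const.
apply: leq_sum => j' _; have [jj'|jj'] := ltnP j' j; last first.
  by rewrite eq_card0// => t; rewrite inE.
exact: card_slab.
Qed.

(** In units of the volume of a cube, finer slabs take at most [1 / 64]. So the even cube carries at
    most [1 + 1 / 64] points, and the interior of the odd cube at least
    [3 / 4 + (3 / 4 - 1 / 64)]. *)
Lemma card_even_lt_odd (j k m : nat) (p : 'I_d -> nat) : j < T -> 0 < d ->
  N' = 64 * d * T -> side j = 8 * d * m ->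
  spacing j.+1 %| p i0 -> spacing j.+1 %| p i1 ->
  #|[pred x : {ffun 'I_d -> 'I_(side j)} * bool |
      x.2 ==> stripes (cube_pt j k.*2 p (fun i => x.1 i))]| <
  #|[pred x : {ffun 'I_d -> 'I_(side j)} * bool |
      [forall i, m <= x.1 i < side j - m] &&
      (x.2 ==> stripes (cube_pt j k.*2.+1 p (fun i => x.1 i)))]|.
Proof.
move=> jT d0 N'E sE p0 p1; set V : finType := ({ffun 'I_d -> 'I_(side j)} : finType).
have cardV : #|V| = side j ^ d by rewrite card_ffun !card_ord.
rewrite (card_prod_bool (fun t : V => [forall i, m <= t i < side j - m])
  (fun t => stripes (cube_pt j k.*2.+1 p (fun i => t i)))).
rewrite (eq_card (B := [pred x : V * bool | predT x.1 &&
  (x.2 ==> stripes (cube_pt j k.*2 p (fun i => x.1 i)))]))//.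
rewrite (card_prod_bool predT
  (fun t : V => stripes (cube_pt j k.*2 p (fun i => t i)))) cardV.
set fin := [pred t : V | finer j (fun i => t i)].
set deep := (fun t : V => [forall i, _]).
have fin64 : 64 * #|fin| <= side j ^ d.
  have := card_finer j; rewrite -/V -/fin {1}N'E.
  have T0 : 0 < T by exact: leq_ltn_trans jT.
  move=> h; rewrite -(leq_pmul2l T0); apply: leq_trans h.
  rewrite (_ : T * _ = #|fin| * (64 * 1 * T)); last by ring.
  by rewrite leq_mul2l leq_mul2r leq_mul2l d0 !orbT.
have deep34 : 3 * side j ^ d <= 4 * #|deep|.
  by have := card_deep sE.
set pe := (fun t : V => stripes (cube_pt j k.*2 p (fun i => t i))).
set po := (fun t : V => stripes (cube_pt j k.*2.+1 p (fun i => t i))).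
rewrite -/deep; set ev := #|[predI predT & pe]|; set od := #|[predI deep & po]|.
have evle : ev <= #|fin|.
  apply: subset_leq_card; apply/fintype.subsetP => t; rewrite !inE/=.
  by apply: contraLR => nf; rewrite /in_mem/= /pe stripes_cube_pt// odd_double.
have odge : #|deep| <= od + #|fin|.
  rewrite -(cardID fin deep) addnC leq_add//.
    apply: subset_leq_card; apply/fintype.subsetP => t; rewrite !inE/=.
    move=> /andP[nf dt]; apply/andP; split=> //.
    by rewrite /in_mem/= /po stripes_cube_pt//= odd_double.
  by apply: subset_leq_card; apply/fintype.subsetP => t; rewrite !inE/= => /andP[].
have s0 : 0 < side j ^ d by rewrite expn_gt0 side_gt0.
move: fin64 deep34 evle odge s0.
move: #|fin| #|deep| ev od (side j ^ d) => *.
by lia.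
Qed.

End Pattern.

(** * Increasing the stretch *)

Section StretchStep.
Variables (R : realType) (d : nat) (i0 i1 : 'I_d).
Variables (n q kappa T N' : nat).
Hypotheses (i01 : i0 != i1) (n_gt0 : (0 < n)%N) (T_gt0 : (0 < T)%N).
(* [kappa] makes the error in [aligned_increments] at most [s / (32 * d * n)] for
   cubes of side [s]; with the grid of mesh [s / q], this displaces the points
   of a cube by less than [s / (8 * d)]. *)
Hypothesis qE : q = (64 * d ^ 2 * n ^ 2)%N.
Hypothesis kappaE : kappa = (256 ^ 2 * (d ^ 2 * n ^ 4 * q ^ d))%N.
Hypothesis TE : T = (2 * n * kappa)%N.
Hypothesis N'E : N' = (64 * d * T)%N.
Local Notation len := (side q N').
Local Notation mesh := (spacing q N').
Local Notation in_cube := (cube_pt i0 q N').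
Local Notation pattern := (stripes i0 i1 q N' T).
Local Notation Zd := (@integer_lattice R d).

Variable c : 'rV[R]_d.

Definition half_e0 : 'rV[R]_d := 2^-1 *: delta_mx ord0 i0.
Definition pt (w : 'I_d -> nat) (b : bool) : 'rV[R]_d :=
  c + (\row_i (w i)%:R) + b%:R *: half_e0.
Definition in_box (w : 'I_d -> nat) : Prop := forall i, (w i < 2 * len T)%N.
Definition shift0 (s : nat) (w : 'I_d -> nat) : 'I_d -> nat :=
  fun i => (w i + (i == i0) * s)%N.

Variables (X : set 'rV[R]_d) (f g : 'rV[R]_d -> 'rV[R]_d).
Hypothesis Zc : Zd c.
Hypothesis X_pt : forall w (b : bool), in_box w -> (b -> pattern w) -> X (pt w b).
Hypothesis X_ptP : forall x, X x -> exists z (b : bool),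
  [/\ Zd z, x = z + b%:R *: half_e0 &
      forall w, in_box w -> z = pt w false -> b -> pattern w].
Hypothesis f_int : forall x, X x -> Zd (f x).
Hypothesis g_X : forall y, Zd y -> X (g y).
Hypothesis gK : forall y, Zd y -> f (g y) = y.
Hypothesis fK : forall x, X x -> g (f x) = x.
Hypothesis f_lip : forall w b w' b', in_box w -> in_box w' ->
  X (pt w b) -> X (pt w' b') ->
  norm2 (f (pt w b) - f (pt w' b')) <= n%:R * norm2 (pt w b - pt w' b').
Hypothesis g_lip : forall w y, in_box w -> Zd y ->
  norm2 (y - f (pt w false)) <= (len T)%:R ->
  norm2 (g y - pt w false) <= n%:R * norm2 (y - f (pt w false)).

Definition stretch (s : nat) (w : 'I_d -> nat) : R :=
  norm2 (f (pt (shift0 s w) false) - f (pt w false)).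

(** The margin [2 * len j] keeps the segment from [p] and the cubes beside it inside the box;
    divisibility places these cubes in a slab of the next smaller scale. *)
Definition grid_point (j : nat) (p : 'I_d -> nat) : Prop :=
  forall i, (mesh j %| p i)%N /\ (p i + 2 * len j <= 2 * len T)%N.

Let d_gt0 : (0 < d)%N := ord_dim_gt0 i0.
Let q_gt0 : (0 < q)%N.
Proof. by rewrite qE !muln_gt0 ?expn_gt0 d_gt0 n_gt0. Qed.
Let N'_gt0 : (0 < N')%N.
Proof. by rewrite N'E !muln_gt0 d_gt0 T_gt0. Qed.
Let N'_even : ~~ odd N'.
Proof. by rewrite N'E !oddM. Qed.
Let kappa_gt0 : (0 < kappa)%N.
Proof. by move: T_gt0; rewrite TE; case: (kappa) => //; rewrite muln0. Qed.

Lemma leq_side j j' : (j <= j')%N -> (len j <= len j')%N.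
Proof.
move=> jj'; apply: leq_pexp2l; last by rewrite ltnS.
by rewrite muln_gt0 q_gt0 N'_gt0.
Qed.

Lemma sideS j : len j.+1 = (q * N' * len j)%N.
Proof. by rewrite /side expnS. Qed.

Lemma X_pt0 w : in_box w -> X (pt w false).
Proof. by move=> bw; apply: X_pt. Qed.

Lemma ptE w b i : pt w b ord0 i =
  c ord0 i + (w i)%:R + b%:R * (2^-1 * (i == i0)%:R).
Proof. by rewrite !mxE eqxx. Qed.

Lemma sub_ptE w b w' b' i : (pt w b - pt w' b') ord0 i =
  (w i)%:R - (w' i)%:R + (b%:R - b'%:R) * (2^-1 * (i == i0)%:R).
Proof. by rewrite [LHS]mxE [X in _ + X]mxE !ptE; ring. Qed.

Lemma norm2_sub_pt w w' (M : nat) :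
  (forall i, (w i <= w' i <= w i + M)%N) ->
  norm2 (pt w' false - pt w false) <= d%:R * M%:R.
Proof.
move=> h; apply: norm2_le_coord => // i; rewrite sub_ptE subrr mul0r addr0.
by have /andP[h1 h2] := h i; rewrite -natrB// normr_nat ler_nat; lia.
Qed.

Lemma int_diff x y : Zd x -> Zd y -> Zd (x - y).
Proof. by move=> hx hy i; rewrite !mxE rpredB. Qed.

Lemma pt_cube_pt (j k m : nat) (p : 'I_d -> nat)
    (t : {ffun 'I_d -> 'I_(len j)}) (z : 'rV[R]_d) : Zd z ->
  (forall i, (m <= t i < len j - m)%N) ->
  (forall i, `|z ord0 i - pt (in_cube j k p (fun i => t i)) false ord0 i| < m%:R) ->
  exists t' : {ffun 'I_d -> 'I_(len j)},
    z = pt (in_cube j k p (fun i => t' i)) false.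
Proof.
move=> Zz deep close.
have l0 : (0 < len j)%N by exact: side_gt0 q_gt0 N'_gt0 j.
pose b i : R := c ord0 i + (p i + (i == i0) * (k * len j))%N%:R.
have hb i : 0 <= z ord0 i - b i < (len j)%:R.
  have := close i; rewrite ptE mul0r addr0 /cube_pt natrD addrA -/(b i).
  rewrite ltr_norml => /andP[h1 h2]; have /andP[] := deep i.
  by rewrite ltn_subRL -(ltr_nat R) -(ler_nat R) natrD => h3 h4; lra.
have hz i : (Num.truncn (z ord0 i - b i))%:R = z ord0 i - b i.
  apply/eqP; rewrite -natrEtruncn -intrEge0 ?(andP (hb i)).1//.
  by rewrite !rpredB ?rpredD ?Zz ?Zc ?natr_int.
have ht i : (Num.truncn (z ord0 i - b i) < len j)%N.
  by rewrite -(ltr_nat R) hz (andP (hb i)).2.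
exists [ffun i => Ordinal (ht i)]; apply/rowP => i.
by rewrite ptE mul0r addr0 /cube_pt natrD ffunE /= hz addrA -/(b i) addrC subrK.
Qed.

Lemma pt_inj w b w' b' : pt w b = pt w' b' -> w =1 w' /\ b = b'.
Proof.
move=> e; have h i : (2 * w i + (i == i0) * b = 2 * w' i + (i == i0) * b')%N.
  have : (pt w b - pt w' b') ord0 i = 0 by rewrite e subrr mxE.
  rewrite sub_ptE => h; apply/eqP; rewrite -(eqr_nat R) !natrD !natrM.
  by apply/eqP; move: h; case: (i == i0) b b' {e} => -[] []; rewrite /=; lra.
have bb : b = b' by have := h i0; rewrite eqxx; case: (b) (b') => -[]; lia.
by split=> // i; have := h i; rewrite bb; lia.
Qed.

(* [v a] is the translation vector [W] of the header, up to a small error, for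
   every grid point [a]; the injection is [x |-> g (f x - W)]. *)
Lemma not_nearly_translated (j k : nat) (p : 'I_d -> nat) : (j < T)%N ->
  (forall i, mesh j.+1 %| p i)%N ->
  (forall k' (t : 'I_d -> nat), (k' <= k.*2.+1)%N -> (forall i, t i < len j)%N ->
     in_box (in_cube j k' p t)) ->
  let v (a : {ffun 'I_d -> 'I_q}) :=
    f (pt (in_cube j k.*2.+1 p (fun i => mesh j * a i)%N) false) -
    f (pt (in_cube j k.*2 p (fun i => mesh j * a i)%N) false) in
  ~ (forall a a', norm2 (v a - v a') <= (len j)%:R / (32 * d%:R * n%:R)).
Proof.
move=> jT pd box v hv.
have d0 := d_gt0; have q0 := q_gt0; have N0 := N'_gt0.
have d0R : 0 < d%:R :> R by rewrite ltr0n.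
have n0R : 0 < n%:R :> R by rewrite ltr0n.
have s0 : (0 < len j)%N by exact: side_gt0.
have mu0 : (0 < mesh j)%N by exact: spacing_gt0.
have sE : len j = (q * mesh j)%N by exact: sideE.
(* The depth [len j / (8 * d)] of the interior, within which points may be displaced without leaving
   the cube. *)
pose m := (8 * T * q * (q * N') ^ j)%N.
have smE : len j = (8 * d * m)%N.
  by rewrite /m /side expnS {1}N'E; ring.
have sle : (64 * d <= len j)%N.
  have : (N' <= len j)%N.
    rewrite /side expnS [(q * N')%N]mulnC -mulnA leq_pmulr//.
    by rewrite muln_gt0 q0 expn_gt0 muln_gt0 q0 N0.
  by apply: leq_trans; rewrite N'E leq_pmulr.
have grid_lt (a : {ffun 'I_d -> 'I_q}) i : (mesh j * a i < len j)%N.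
  by rewrite sE mulnC ltn_pmul2r.
pose W := v [ffun=> Ordinal q0].
have vZ a : Zd (v a).
  by apply: int_diff; apply/f_int/X_pt0/box => //; exact: leqnSn.
pose Src := [pred x : {ffun 'I_d -> 'I_(len j)} * bool |
      [forall i, m <= x.1 i < len j - m]%N &&
      (x.2 ==> pattern (in_cube j k.*2.+1 p (fun i => x.1 i)))].
pose Tgt := [pred x : {ffun 'I_d -> 'I_(len j)} * bool |
      x.2 ==> pattern (in_cube j k.*2 p (fun i => x.1 i))].
pose src (x : {ffun 'I_d -> 'I_(len j)} * bool) :=
  pt (in_cube j k.*2.+1 p (fun i => x.1 i)) x.2.
have Xsrc x : x \in Src -> X (src x).
  rewrite inE => /andP[_ /implyP hx]; apply: X_pt => //; exact: box.
have ex x : exists y, x \in Src -> y \in Tgt /\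
    g (f (src x) - W) = pt (in_cube j k.*2 p (fun i => y.1 i)) y.2.
  have [xS|xS] := boolP (x \in Src); last by exists x.
  have Zy : Zd (f (src x) - W).
    by apply: int_diff; [apply: f_int; exact: Xsrc|exact: vZ].
  have [z [b [Zz xE hz]]] := X_ptP (g_X Zy).
  have a_lt i : (x.1 i %/ mesh j < q)%N by rewrite ltn_divLR// -sE.
  (* [a] rounds [x] down to the grid, where the translation vector is known up to [tol]. *)
  pose a := [ffun i => Ordinal (a_lt i)].
  pose P k' := pt (in_cube j k' p (fun i => mesh j * a i)%N) false.
  have aE i : (mesh j * a i = x.1 i - x.1 i %% mesh j)%N.
    by rewrite ffunE /= {2}(divn_eq (x.1 i) (mesh j)) addnK mulnC.
  have modlt i : (x.1 i %% mesh j < mesh j)%N by rewrite ltn_mod.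
  have modle i : (x.1 i %% mesh j <= x.1 i)%N by exact: leq_mod.
  have dist1 : norm2 (src x - P k.*2.+1) <= d%:R * (mesh j)%:R.
    apply: norm2_le_coord => // i; rewrite sub_ptE /cube_pt aE.
    rewrite !natrD natrB// (_ : _ + _ = (x.1 i %% mesh j)%:R +
       (x.2%:R - false%:R) * (2^-1 * (i == i0)%:R)); last by ring.
    rewrite subr0.
    have : (x.1 i %% mesh j)%:R + 1 <= (mesh j)%:R :> R.
      by rewrite natr1 ler_nat.
    rewrite ger0_norm ?addr_ge0 ?mulr_ge0 ?invr_ge0//.
    by case: x.2 (i == i0) => -[]; rewrite /=; lra.
  pose tol : R := (len j)%:R / (32 * d%:R * n%:R).
  have boxP k' : (k' <= k.*2.+1)%N ->
      in_box (in_cube j k' p (fun i => mesh j * a i)%N).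
    by move=> hk; apply: box => // i; exact: grid_lt.
  have dist2 : norm2 ((f (src x) - W) - f (P k.*2)) <=
      n%:R * (d%:R * (mesh j)%:R) + tol.
    have -> : (f (src x) - W) - f (P k.*2) = (f (src x) - f (P k.*2.+1)) + (v a - W).
      by rewrite /v -/(P k.*2) -/(P k.*2.+1); apply/rowP => i; rewrite !mxE; ring.
    apply: le_trans (ler_norm2D _ _) _; apply: lerD; last exact: hv.
    have := @f_lip (in_cube j k.*2.+1 p (fun i => x.1 i)) x.2 _ false
        (box _ _ (leqnn _) (fun i => ltn_ord _)) (boxP _ (leqnn _))
        (Xsrc _ xS) (X_pt0 (boxP _ (leqnn _))).
    by move=> /le_trans; apply; rewrite ler_pM2l.
  have qR : q%:R = 64 * d%:R ^+ 2 * n%:R ^+ 2 :> R.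
    by rewrite qE -!mulnn !natrM; ring.
  have sR : (len j)%:R = q%:R * (mesh j)%:R :> R by rewrite sE natrM.
  have muR : (mesh j)%:R = (len j)%:R / (64 * d%:R ^+ 2 * n%:R ^+ 2) :> R.
    by rewrite sR qR; field; rewrite !gt_eqF.
  have n1 : 1 <= n%:R :> R by rewrite ler1n.
  have d1 : 1 <= d%:R :> R by rewrite ler1n.
  (* In this unit the displacement is at most [3 * u], rounding costs at most [u], the shift by one
     half at most [u / 2] since [1 <= u], and the depth is [8 * u]. *)
  pose u : R := (len j)%:R / (64 * d%:R).
  have u1 : 1 <= u.
    by rewrite ler_pdivlMr ?mulr_gt0// mul1r -natrM ler_nat.
  have dist3 : norm2 (g (f (src x) - W) - P k.*2) <= 3 * u.
    have bnd : n%:R * (n%:R * (d%:R * (mesh j)%:R) + tol) = 3 * u.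
      by rewrite muR /tol /u; field; rewrite !gt_eqF.
    (* [g_lip] is only local, so the distance has to be compared with [len T] first. *)
    have dist2' : norm2 ((f (src x) - W) - f (P k.*2)) <= (len T)%:R.
      apply: le_trans dist2 _; apply: le_trans (_ : (len j)%:R <= _).
        have : n%:R * (d%:R * (mesh j)%:R) + tol <= 3 * u.
          by rewrite -bnd ler_peMl// addr_ge0 ?mulr_ge0// divr_ge0// !mulr_ge0.
        move=> /le_trans; apply; rewrite /u mulrA ler_pdivrMr ?mulr_gt0//.
        by have : 0 <= (len j)%:R :> R by []; nra.
      by rewrite ler_nat leq_side// ltnW.
    apply: le_trans (g_lip (boxP _ (leqnSn _)) Zy dist2') _.
    by rewrite -bnd ler_pM2l.
  have mu_le : (mesh j)%:R <= u.
    rewrite muR /u ler_pdivrMr ?mulr_gt0 ?exprn_gt0// mulrAC ler_pdivlMr ?mulr_gt0//.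
    have s0R : 0 <= (len j)%:R :> R by [].
    have : d%:R <= d%:R ^+ 2 * n%:R ^+ 2 :> R.
      by rewrite expr2 -mulrA ler_peMr ?(ltW d0R)// mulr_ege1// exprn_ege1.
    by nra.
  have mR : m%:R = 8 * u.
    rewrite /u {1}smE !natrM; field.
    by rewrite gt_eqF.
  have [t' tE] : exists t' : {ffun 'I_d -> 'I_(len j)},
      z = pt (in_cube j k.*2 p (fun i => t' i)) false.
    apply: (@pt_cube_pt j k.*2 m p x.1) => //.
      by move: xS; rewrite inE => /andP[/forallP].
    move=> i; rewrite mR.
    have : `|(g (f (src x) - W) - P k.*2) ord0 i| <= 3 * u.
      by apply: le_trans (ler_coord_norm2 _ i) dist3.
    have -> : (g (f (src x) - W) - P k.*2) ord0 i =
        z ord0 i + b%:R * (2^-1 * (i == i0)%:R) - P k.*2 ord0 i.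
      rewrite xE; move: (P k.*2) => y.
      by rewrite !mxE eqxx.
    rewrite /P !ptE /cube_pt aE !natrD natrB//.
    have : (x.1 i %% mesh j)%:R + 1 <= (mesh j)%:R :> R.
      by rewrite natr1 ler_nat.
    have : 0 <= (x.1 i %% mesh j)%:R :> R by [].
    rewrite !ltr_norml !ler_norml => m0 m1.
    by case: b (i == i0) {hz xE} => -[]; rewrite /=; lra.
  exists (t', b) => _; split; last by rewrite /= xE tE /pt !scale0r addr0.
  rewrite inE /=; apply/implyP; apply: hz; last by rewrite tE.
  by apply: box; rewrite ?leqnSn.
have /boolp.choice[phi phiP] := ex.
(* [f] is injective on [X] and [g] on the lattice, and the translation by [W] is the same for all
   points. *)
have inj : {in Src &, injective phi}.
  move=> x x' xS xS' e.
  have [_ h] := phiP x xS; have [_ h'] := phiP x' xS'.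
  have : f (src x) - W = f (src x') - W.
    rewrite -(gK (int_diff (f_int (Xsrc _ xS)) (vZ _))).
    by rewrite -(gK (int_diff (f_int (Xsrc _ xS')) (vZ _))) h h' e.
  move=> /addIr /(congr1 g); rewrite !fK; [|exact: Xsrc..].
  move=> /pt_inj[ew eb]; case: x x' ew eb {xS xS' e h h'} => [t b] [t' b'] /= ew ->.
  congr (_, _); apply/ffunP => i; apply/val_inj.
  by have := ew i; rewrite /cube_pt => /addnI.
have le_card : (#|Src| <= #|Tgt|)%N.
  rewrite -(card_in_image inj); apply: subset_leq_card; apply/fintype.subsetP => y.
  by move=> /fintype.imageP[x xS ->]; have [] := phiP x xS.
have := card_even_lt_odd i01 q0 N0 N'_even k jT d0 N'E smE (pd i0) (pd i1).
by rewrite ltnNge -/Src -/Tgt le_card.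
Qed.

Lemma norm2_delta : norm2 (delta_mx ord0 i0 : 'rV[R]_d) = 1.
Proof.
rewrite /norm2 (bigD1 i0)//= big1 ?addr0 => [|i /negbTE ii0].
  by rewrite mxE !eqxx expr1n sqrtr1.
by rewrite mxE eqxx ii0 expr0n.
Qed.

Lemma norm2_shift0 s w : norm2 (pt (shift0 s w) false - pt w false) = s%:R.
Proof.
have -> : pt (shift0 s w) false - pt w false = s%:R *: delta_mx ord0 i0.
  apply/rowP => i; rewrite sub_ptE /shift0 natrD natrM !mxE eqxx /=.
  by case: (i == i0); rewrite /=; ring.
by rewrite norm2Z norm2_delta mulr1 ger0_norm.
Qed.

Lemma in_box_cube_pt j k p (t : 'I_d -> nat) : grid_point j.+1 p ->
  (k <= q * N')%N -> (forall i, t i < len j)%N -> in_box (in_cube j k p t).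
Proof.
move=> gp kN tl i; have [_] := gp i; apply: leq_trans.
rewrite /cube_pt -addnA ltn_add2l.
have qN : (2 <= q * N')%N.
  rewrite N'E (leq_trans (_ : 2 <= 64)%N)// mulnCA !mulnA -mulnA.
  by rewrite -!mulnA leq_pmulr// !muln_gt0 q_gt0 d_gt0 T_gt0.
apply: leq_trans (_ : q * N' * len j + len j <= _)%N.
  rewrite -addnS leq_add//; case: (i == i0); rewrite ?mul0n// mul1n.
  by rewrite leq_mul2r kN orbT.
by rewrite mul2n -addnn sideS leq_add2l leq_pmull// muln_gt0 q_gt0 N'_gt0.
Qed.

Lemma cube_ptS j k p t : in_cube j k.+1 p t = shift0 (len j) (in_cube j k p t).
Proof.
by apply/funext => i; rewrite /shift0 /cube_pt; case: (i == i0); ring.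
Qed.

Lemma grid_point_in_box j p : grid_point j p ->
  in_box p /\ in_box (shift0 (len j) p).
Proof.
move=> gp; have := side_gt0 q_gt0 N'_gt0 j => l0; split=> i; have [_] := gp i.
  by move: l0; move: (len j) (len T) (p i); clear; lia.
rewrite /shift0; move: (i == i0) l0; move: (len j) (len T) (p i); clear.
by move=> a b e []; lia.
Qed.

Lemma stretch_le j p : grid_point j p -> stretch (len j) p <= n%:R * (len j)%:R.
Proof.
move=> /grid_point_in_box[bp bs].
rewrite -[X in _ <= _ * X](norm2_shift0 (len j) p).
by apply: f_lip => //; exact: X_pt0.
Qed.

(** The [q ^ d] polygonal lines join the grid points of the first cube to their translates along the
    row. Unless one of their steps is the desired shorter segment, [aligned_increments] yields two
    consecutive cubes excluded by [not_nearly_translated]. *)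
Lemma stretch_step j p (A : R) : (j < T)%N -> grid_point j.+1 p -> 0 < A ->
  A * (len j.+1)%:R <= stretch (len j.+1) p ->
  exists2 p', grid_point j p' &
    (1 + kappa%:R^-1) * A * (len j)%:R <= stretch (len j) p'.
Proof.
move=> jT gp A0 Ap; apply: contrapT => hno.
have d0 := d_gt0; have q0 := q_gt0; have N0 := N'_gt0; have k0 := kappa_gt0.
have d0R : 0 < d%:R :> R by rewrite ltr0n.
have n0R : 0 < n%:R :> R by rewrite ltr0n.
have k0R : 0 < kappa%:R :> R by rewrite ltr0n.
have q0R : 0 < q%:R :> R by rewrite ltr0n.
have s0 : (0 < len j)%N by exact: side_gt0.
have s0R : 0 < (len j)%:R :> R by rewrite ltr0n.
have An : A <= n%:R.
  rewrite -(ler_pM2r (_ : 0 < (len j.+1)%:R)) ?ltr0n ?side_gt0//.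
  exact: le_trans Ap (stretch_le gp).
pose s : R := (len j)%:R.
pose B := (1 + kappa%:R^-1) * A * s.
have B0 : 0 <= B.
  apply: mulr_ge0; last exact: ltW.
  by apply: mulr_ge0; [rewrite addr_ge0// invr_ge0|exact: ltW].
(* The segment of scale [j.+1] consists of [2 * m] sides of cubes of scale [j]. *)
pose m := (32 * q * d * T)%N.
have mE : m.*2 = (q * N')%N by rewrite /m N'E -mul2n; ring.
have m0 : (0 < m)%N by rewrite /m !muln_gt0 q0 d0 T_gt0.
pose F (a : {ffun 'I_d -> 'I_q}) k :=
  f (pt (in_cube j k p (fun i => mesh j * a i)%N) false).
have alt (a : {ffun 'I_d -> 'I_q}) i : (mesh j * a i < len j)%N.
  by rewrite sideE mulnC ltn_pmul2r// spacing_gt0.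
have bcube (a : {ffun 'I_d -> 'I_q}) k : (k <= m.*2)%N ->
    in_box (in_cube j k p (fun i => mesh j * a i)%N).
  by rewrite mE => km; apply: in_box_cube_pt.
have [bp bs] := grid_point_in_box gp.
(* The lines begin and end within [d * s] of the ends of the segment, whence the error [n * (d * s)]
   after applying [f]. *)
have := @aligned_increments R d _ m F (f (pt p false))
  (f (pt (shift0 (len j.+1) p) false)) (A * (len j.+1)%:R) B
  (n%:R * (d%:R * s)) m0.
case.
- by rewrite mulr_gt0// ltr0n side_gt0.
- exact: B0.
- exact: Ap.
- move=> a; apply: le_trans (f_lip (bcube a 0%N (leq0n _)) bp
    (X_pt0 (bcube a 0%N (leq0n _))) (X_pt0 bp)) _.
  rewrite ler_pM2l//; apply: norm2_sub_pt => i.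
  rewrite /cube_pt mul0n muln0 addn0 leq_addr/= leq_add2l.
  exact: ltnW.
- move=> a; apply: le_trans (f_lip (bcube a m.*2 (leqnn _)) bs
    (X_pt0 (bcube a m.*2 (leqnn _))) (X_pt0 bs)) _.
  rewrite ler_pM2l//; apply: norm2_sub_pt => i.
  rewrite /cube_pt /shift0 mE -sideS leq_addr/= leq_add2l.
  exact: ltnW.
(* A step longer than [B] would itself be the shorter segment denied by [hno]. *)
- move=> a k km; rewrite leNgt; apply/negP => hB; apply: hno.
  exists (in_cube j k p (fun i => mesh j * a i)%N); last first.
    by rewrite /stretch -cube_ptS ltW.
  move=> i; have [pd pl] := gp i; split.
    apply: dvdn_add; last exact: dvdn_mulr.
    apply: dvdn_add; first by apply: dvdn_trans pd; exact: dvdn_spacing.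
    by apply: dvdn_mull; apply: dvdn_mull; rewrite sideE; exact: dvdn_mull.
  apply: leq_trans pl; rewrite /cube_pt -!addnA leq_add2l sideS -mE.
  have h1 : ((i == i0) * (k * len j) <= k * len j)%N.
    by rewrite -[X in (_ <= X)%N]mul1n leq_mul2r leq_b1 orbT.
  have m2 : (2 <= m)%N.
    rewrite /m -!mulnA (leq_trans (_ : 2 <= 32)%N)// leq_pmulr//.
    by rewrite !muln_gt0 q0 d0 T_gt0.
  apply: leq_trans (leq_add h1 (leq_add (ltnW (alt a i)) (leqnn _))) _.
  rewrite (_ : k * len j + (len j + 2 * len j) = (k + 3) * len j)%N; last by ring.
  rewrite mulnA leq_mul2r; apply/orP; right.
  by move: km m2; clear; lia.
move=> i im hi.
have i2 : (i.*2.+1 <= q * N')%N by rewrite -mE ltn_double.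
have pd i' : (mesh j.+1 %| p i')%N by have [] := gp i'.
apply: (@not_nearly_translated j i p jT pd).
  by move=> k' t hk tl; apply: in_box_cube_pt => //; exact: leq_trans i2.
move=> a a'; apply: le_trans (hi a a') _.
rewrite card_ffun !card_ord -/s.
pose y : R := s / (64 * d%:R * n%:R).
have y0 : 0 <= y by rewrite divr_ge0 ?mulr_ge0.
have -> : s / (32 * d%:R * n%:R) = 2 * y.
  by rewrite /y; field; rewrite !gt_eqF.
rewrite ler_pM2l// -[leRHS](ger0_norm y0) -sqrtr_sqr ler_sqrt ?sqr_ge0//.
have m0R : 0 < m%:R :> R by rewrite ltr0n.
have lenSR : (len j.+1)%:R = 2 * m%:R * s :> R.
  by rewrite sideS -mE natrM -mul2n natrM.
have kR : kappa%:R = 256 ^+ 2 * (d%:R ^+ 2 * n%:R ^+ 4 * q%:R ^+ d) :> R.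
  by rewrite kappaE -!mulnn !natrM !natrX; ring.
set Q : R := (q ^ d)%:R.
have QE : Q = q%:R ^+ d by rewrite /Q natrX.
have Q0 : 0 < Q by rewrite QE exprn_gt0.
have kle : kappa%:R^-1 <= 1 :> R by rewrite invf_le1// ler1n.
have dm : d%:R / m%:R <= kappa%:R^-1 :> R.
  rewrite ler_pdivrMr// mulrC ler_pdivlMr// -natrM ler_nat /m TE.
  rewrite (_ : 32 * q * d * _ = (64 * (q * n)) * (d * kappa))%N; last by ring.
  by rewrite leq_pmull// !muln_gt0 q0 n_gt0.
(* The excess consists of [2 * A * s / kappa], from the factor [1 + 1 / kappa] in [B], and of the
   endpoint error spread over [m] steps, which [dm] bounds by [2 * n * s / kappa]; finally
   [A <= n]. *)
have total : Q * (m.*2%:R * B - A * (len j.+1)%:R + 2 * (n%:R * (d%:R * s))) / m%:R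
    <= Q * (4 * n%:R * s / kappa%:R).
  rewrite -mulrA ler_pM2l//.
  have -> : (m.*2%:R * B - A * (len j.+1)%:R + 2 * (n%:R * (d%:R * s))) / m%:R
      = 2 * A * s / kappa%:R + 2 * n%:R * s * (d%:R / m%:R).
    rewrite lenSR -mul2n natrM /B; field.
    by rewrite !gt_eqF.
  have -> : 4 * n%:R * s / kappa%:R =
      2 * n%:R * s / kappa%:R + 2 * n%:R * s * kappa%:R^-1 by ring.
  apply: lerD; last by rewrite ler_wpM2l// !mulr_ge0// ltW.
  by rewrite ler_pM2r ?invr_gt0// ler_pM2r// ler_pM2l.
have B4 : 2 * B <= 4 * n%:R * s.
  rewrite /B mulrA ler_pM2r//.
  have : (1 + kappa%:R^-1) * A <= 2 * n%:R.
    apply: ler_pM; [|exact: ltW|lra|exact: An].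
    by apply: addr_ge0 => //; rewrite invr_ge0.
  by lra.
(* The constant [256 ^ 2] and the powers in [kappa] are chosen for this equality. *)
have -> : y ^+ 2 = 4 * n%:R * s * (Q * (4 * n%:R * s / kappa%:R)).
  by rewrite /y kR QE; field; rewrite !gt_eqF// exprn_gt0.
apply: le_trans (_ : 2 * B * (Q * (4 * n%:R * s / kappa%:R)) <= _).
  by apply: ler_wpM2l total; rewrite mulr_ge0.
apply: ler_wpM2r B4; apply: mulr_ge0; first exact: ltW.
by rewrite divr_ge0// !mulr_ge0// ltW.
Qed.

(** At the top scale the stretch is at least [1 / n], since [g] is Lipschitz. Over
    [T = 2 * n * kappa] scales it gains at least the factor [2 ^ (2 * n) > n ^ 2], and so exceeds
    the Lipschitz constant [n] of [f]. *)
Lemma no_lipschitz_bijection : False.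
Proof.
have n0R : 0 < n%:R :> R by rewrite ltr0n.
have k0R : 0 < kappa%:R :> R by rewrite ltr0n kappa_gt0.
have lenR j : 0 < (len j)%:R :> R by rewrite ltr0n side_gt0 ?q_gt0 ?N'_gt0.
pose lam : R := 1 + kappa%:R^-1.
have lam0 : 0 < lam by rewrite ltr_wpDr// invr_ge0.
have iter r : (r <= T)%N -> exists2 p, grid_point (T - r) p &
    lam ^+ r / n%:R * (len (T - r))%:R <= stretch (len (T - r)) p.
  elim: r => [_|r IH rT].
    have gp0 : grid_point T (fun=> 0%N) by move=> i; rewrite dvdn0.
    rewrite subn0; exists (fun=> 0%N) => //.
    have [bp bs] := grid_point_in_box gp0.
    rewrite expr0 mul1r mulrC ler_pdivrMr// mulrC.
    have n1 : 1 <= n%:R :> R by rewrite ler1n.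
    (* [g_lip] reaches only as far as [len T]; if the image is longer than that, the bound is
       immediate. *)
    have [h|h] := leP (stretch (len T) (fun=> 0%N)) (len T)%:R; last first.
      by apply: le_trans (ltW h) _; rewrite ler_peMl// (le_trans _ (ltW h)).
    have := g_lip bp (f_int (X_pt0 bs)) h.
    by rewrite fK ?norm2_shift0//; exact: X_pt0.
  have [p] := IH (ltnW rT).
  have -> : (T - r = (T - r.+1).+1)%N by rewrite subnSK.
  move=> gp Ap.
  have [||p' gp' Ap'] := @stretch_step (T - r.+1) p _ _ gp _ Ap.
  - by rewrite ltn_subrL T_gt0.
  - by rewrite divr_gt0// exprn_gt0.
  by exists p' => //; rewrite exprS -[lam * _ / _]mulrA.
have [p gp] := iter T (leqnn T).
move=> /le_trans/(_ (stretch_le gp)); rewrite ler_pM2r// ler_pdivrMr//.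
apply/negP; rewrite -ltNge TE [(2 * n * _)%N]mulnC exprM.
have lamk : 2 <= lam ^+ kappa.
  have -> : 2 = 1 + kappa%:R * kappa%:R^-1 :> R by rewrite mulfV ?gt_eqF.
  by apply: bernoulli_add; rewrite invr_ge0.
apply: (@lt_le_trans _ _ (2 ^+ (2 * n))); last first.
  by apply: lerXn2r => //; rewrite nnegrE ?exprn_ge0 ?(ltW lam0).
rewrite mulnC exprM -natrX expr2 -!natrM ltr_nat.
by apply: ltn_mul; exact: ltn_expl.
Qed.

End StretchStep.

(** * Homogeneous mappings on large balls *)

Section HomogeneousLipschitz.
Variables (R : realType) (d : nat).

(* At a scale [r] comparable to the radius, [x] and [y] satisfy
   [norm2 (x - y) / r >= 1 / (2 * r)], which bounds the logarithm. *)
Lemma homogeneous_lipschitz (omega : modulus R) (alpha a0 : R)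
    (X Y : set 'rV[R]_d) (f : 'rV[R]_d -> 'rV[R]_d) :
  0 <= alpha -> 0 < a0 ->
  (forall t : R, 0 < t < a0 -> t < modulus_dom omega ->
     omega t = t * ln (1 / t) `^ alpha) ->
  (forall x y, X x -> X y -> x != y -> 2^-1 <= norm2 (x - y)) ->
  homogeneous_mapping omega X Y f ->
  exists K C : R, [/\ 0 < K, 1 <= C & forall rho : R, 1 <= rho ->
    forall x y, X x -> X y -> norm2 x <= rho -> norm2 y <= rho ->
      norm2 (f x - f y) <= K * ln (C * rho) `^ alpha * norm2 (x - y)].
Proof.
move=> al0 a00 omE sep [_ [K [a [K0 /andP[apos a1] hK]]]].
have dom0 := modulus_dom_gt0 omega.
pose b := Num.min (Num.min a a0) (modulus_dom omega).
have b0 : 0 < b by rewrite !lt_min apos a00 dom0.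
have ba : b <= a by rewrite !ge_min lexx.
have ba0 : b <= a0 by rewrite !ge_min lexx !orbT.
have bdom : b <= modulus_dom omega by rewrite !ge_min lexx !orbT.
have b1 : b < 1 by exact: le_lt_trans a1.
(* At scale [r = 4 * rho / b], distances up to [2 * rho] have ratios below [b]; separation by
   [1 / 2] bounds the inverse ratio by [2 * r = 8 / b * rho]. *)
exists K, (8 / b); split=> //.
  by rewrite ler_pdivlMr// mul1r; lra.
move=> rho rho1 x y Xx Xy xr yr.
have [->|xy] := eqVneq x y.
  by rewrite !subrr !norm2_0 mulr0.
pose r := 4 * rho / b.
have rho0 : 0 < rho by exact: lt_le_trans rho1.
have r0 : 0 < r by rewrite divr_gt0 ?mulr_gt0.
have rhor : rho < r.
  by rewrite ltr_pdivlMr//; nra.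
have s0 := sep _ _ Xx Xy xy; set D := norm2 (x - y) in s0 *.
have D0 : 0 < D by apply: lt_le_trans s0; rewrite invr_gt0.
have Dle : D <= 2 * rho.
  by apply: le_trans (ler_norm2B _ _) _; rewrite mulr2n mulrDl mul1r lerD.
have Db : D < b * r.
  by rewrite /r mulrCA mulfV ?gt_eqF// mulr1; lra.
have Dr : D / r < b by rewrite ltr_pdivrMr.
have Dr0 : 0 < D / r by rewrite divr_gt0.
have := hK r y x r0.
rewrite -/D => h.
have {}h : norm2 (f x - f y) <= K * r * omega (D / r).
  apply: h.
  - by split=> //; exact: le_lt_trans rhor.
  - by split=> //; exact: le_lt_trans rhor.
  - by rewrite eq_sym.
  - by apply: lt_le_trans Db _; rewrite ler_pM2r.
  - exact: lt_le_trans bdom.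
apply: le_trans h _.
rewrite omE ?Dr0/= ?(lt_le_trans Dr)//.
rewrite mulrA (_ : K * r * (D / r) = K * D); last first.
  by field; rewrite gt_eqF.
rewrite mulrAC ler_pM2r// ler_pM2l//.
apply: ge0_ler_powR => //; rewrite ?nnegrE.
- by apply: ln_ge0; rewrite div1r invf_ge1// (le_trans (ltW Dr))// ltW.
- apply: ln_ge0; apply: le_trans rho1 _; rewrite ler_peMl ?(ltW rho0)//.
  by rewrite ler_pdivlMr// mul1r; lra.
rewrite ler_ln ?posrE; [|exact: divr_gt0|by rewrite mulr_gt0// divr_gt0].
rewrite div1r invf_div ler_pdivrMr//.
have bi0 : 0 < rho / b by rewrite divr_gt0.
have -> : r = 4 * (rho / b) by rewrite /r mulrA.
have -> : 8 / b * rho = 8 * (rho / b) by rewrite mulrAC mulrA.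
by nra.
Qed.

(** The exponent is half of [1 / P], so the left side grows at most like the square root of [n], and
    large [n] absorb all constants. *)
Lemma powR_root_le (P : nat) (K c : R) : (0 < P)%N -> 0 < K -> 0 < c ->
  exists n0 : nat, forall n, (n0 <= n)%N -> forall L, 0 <= L ->
    L <= c * n%:R ^+ P -> K * L `^ (2 * P%:R)^-1 <= n%:R.
Proof.
move=> P0 K0 c0; set al := (2 * P%:R)^-1.
have PR : 0 < P%:R :> R by rewrite ltr0n.
have al0 : 0 <= al by rewrite invr_ge0 mulr_ge0.
pose M := K * c `^ al.
have M0 : 0 <= M by rewrite mulr_ge0 ?powR_ge0// ltW.
exists (Num.truncn (M ^+ 2)).+1 => n hn L L0 hL.
have Mn : M ^+ 2 <= n%:R.
  apply: ltW; apply: lt_le_trans (truncnS_gt _) _.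
  by rewrite ler_nat.
have n0 : 0 <= n%:R :> R by [].
have hpow : L `^ al <= c `^ al * Num.sqrt n%:R.
  apply: le_trans (_ : (c * n%:R ^+ P) `^ al <= _).
    by apply: ge0_ler_powR; rewrite ?nnegrE// mulr_ge0 ?exprn_ge0// ltW.
  rewrite powRM ?(ltW c0) ?exprn_ge0// -powR_mulrn// -powRrM.
  have -> : P%:R * al = 2^-1 by rewrite /al; field; rewrite gt_eqF.
  by rewrite powR12_sqrt.
apply: le_trans (ler_wpM2l (ltW K0) hpow) _; rewrite mulrA -/M.
rewrite -[leRHS]sqr_sqrtr// expr2; apply: ler_wpM2r; first exact: sqrtr_ge0.
by rewrite -[leLHS]ger0_norm// -sqrtr_sqr ler_sqrt.
Qed.

End HomogeneousLipschitz.

(** * The net *)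

Section Scales.
Variable d : nat.
Local Open Scope nat_scope.

Definition net_q (n : nat) : nat := 64 * d ^ 2 * n ^ 2.
Definition net_kappa (n : nat) : nat := 256 ^ 2 * (d ^ 2 * n ^ 4 * net_q n ^ d).
Definition net_T (n : nat) : nat := 2 * n * net_kappa n.
Definition net_N' (n : nat) : nat := 64 * d * net_T n.
Definition net_size (n : nat) : nat   := side (net_q n) (net_N' n) (net_T n).

Hypothesis d_gt0 : 0 < d.

Lemma net_q_gt0 n : 0 < n -> 0 < net_q n.
Proof. by move=> n0; rewrite /net_q !muln_gt0 ?expn_gt0 d_gt0 n0. Qed.

Lemma net_T_gt0 n : 0 < n -> 0 < net_T n.
Proof.
move=> n0; rewrite /net_T /net_kappa !muln_gt0 ?expn_gt0 n0.
by rewrite !muln_gt0 ?expn_gt0 ?d_gt0 ?n0 ?net_q_gt0.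
Qed.

Lemma net_N'_gt0 n : 0 < n -> 0 < net_N' n.
Proof. by move=> n0; rewrite /net_N' muln_gt0 net_T_gt0// muln_gt0 d_gt0. Qed.

Lemma net_size_gt0 n : 0 < n -> 0 < net_size n.
Proof. by move=> n0; rewrite side_gt0 ?net_q_gt0 ?net_N'_gt0. Qed.

Lemma leq_net_size n n' : 0 < n -> n <= n' -> net_size n <= net_size n'.
Proof.
move=> n0 nn'.
have nk k : n ^ k <= n' ^ k by case: k => // k; rewrite leq_exp2r.
have hq : net_q n <= net_q n' by rewrite leq_mul2l nk orbT.
have hT : net_T n <= net_T n'.
  apply: leq_mul; first by rewrite leq_mul2l nn' orbT.
  rewrite leq_mul2l; apply/orP; right.
  apply: leq_mul; first by rewrite leq_mul2l nk orbT.
  by case: (d) d_gt0 hq => // d' _ hq; rewrite leq_exp2r.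
have hN : net_N' n <= net_N' n' by rewrite leq_mul2l hT orbT.
apply: (@leq_trans ((net_q n' * net_N' n') ^ (net_T n).+1)).
  by rewrite leq_exp2r// leq_mul.
rewrite leq_pexp2l// muln_gt0 net_q_gt0 ?net_N'_gt0//; exact: leq_trans nn'.
Qed.

(** Estimating a logarithm by its argument, the left side bounds the logarithm of [net_size n]. Its
    degree comes from [net_T], of degree [5 + 2 * d] and occurring twice, and [net_q], of degree
    2. *)
Lemma net_exponent_le : exists2 C, 0 < C & forall n, 0 < n ->
  (net_T n).+1 * (net_q n * net_N' n) <= C * n ^ (12 + 4 * d).
Proof.
pose B := 2 * (256 ^ 2 * (d ^ 2 * (64 * d ^ 2) ^ d)).
have B0 : 0 < B by rewrite /B !muln_gt0 ?expn_gt0 !muln_gt0 ?expn_gt0 d_gt0.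
exists (2 * 64 * 64 * d ^ 3 * B ^ 2).
  by rewrite muln_gt0 [X in _ && X]expn_gt0 B0 muln_gt0 expn_gt0 d_gt0.
move=> n n0.
have TE : net_T n = B * n ^ (5 + 2 * d).
  rewrite /net_T /net_kappa /net_q /B expnMn -expnM expnD.
  by rewrite (_ : n ^ 5 = n * n ^ 4); [ring|rewrite -expnS].
have T0 := net_T_gt0 n0.
apply: (@leq_trans ((2 * net_T n) * (net_q n * net_N' n))).
  by rewrite leq_mul2r; apply/orP; right; rewrite mul2n -addnn -addn1 leq_add2l.
have -> : 2 * net_T n * (net_q n * net_N' n) =
    2 * 64 * 64 * (d ^ 2 * d) * n ^ 2 * net_T n ^ 2.
  by rewrite /net_N' /net_q; move: (net_T n) => t; ring.
rewrite TE expnMn -expnM.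
rewrite (_ : n ^ (12 + 4 * d) = n ^ 2 * n ^ ((5 + 2 * d) * 2)); last first.
  by rewrite -expnD; congr (_ ^ _); lia.
have -> : d ^ 2 * d = d ^ 3 by rewrite -expnSr.
move: (n ^ ((5 + 2 * d) * 2)) (n ^ 2) (B ^ 2) (d ^ 3) => a b c e.
by apply: eq_leq; ring.
Qed.
End Scales.

Section Net.
Variables (R : realType) (d : nat) (i0 i1 : 'I_d).
Hypothesis i01 : i0 != i1.
Local Notation Zd := (@integer_lattice R d).
Local Notation S := (net_size d).
Local Notation half := (half_e0 R i0).

Let d_gt0 : (0 < d)%N := ord_dim_gt0 i0.

Definition net_pattern (n : nat) : ('I_d -> nat) -> bool :=
  stripes i0 i1 (net_q d n) (net_N' d n) (net_T d n).

(* The [n]-th box has side [2 * S n] and lies at distance [n] times its side from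
   the origin, so that the boxes together have density zero. *)
Definition extra (u : 'I_d -> nat) : Prop := exists n w,
  [/\ (0 < n)%N, forall i, (w i < 2 * S n)%N, net_pattern n w &
      forall i, u i = ((i == i0) * (2 * n * S n) + w i)%N].

Definition extra_points : set 'rV[R]_d :=
  [set x | exists2 u, extra u & x = \row_i (u i)%:R + half].

Definition net : set 'rV[R]_d := Zd `|` extra_points.

(** The boxes occupy disjoint ranges in direction [i0] because [net_size] is monotone, so no other
    pattern contributes to box [n]. *)
Lemma extraP n w : (0 < n)%N -> (forall i, w i < 2 * S n)%N ->
  extra (fun i => (i == i0) * (2 * n * S n) + w i)%N -> net_pattern n w.
Proof.
move=> n0 wl [n' [w' [n'0 w'l pw' e]]].
have e0 := e i0; rewrite eqxx !mul1n in e0.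
have sub a b : (0 < a)%N -> (a < b)%N -> (2 * a * S a + 2 * S a <= 2 * b * S b)%N.
  move=> a0 ab; rewrite -mulnDl; apply: leq_mul; last by rewrite leq_net_size// ltnW.
  by lia.
have nn : n = n'.
  have := wl i0; have := w'l i0.
  have [lt|lt|//] := ltngtP n n'.
    by have := sub n n' n0 lt; lia.
  by have := sub n' n n'0 lt; lia.
subst n'; suff -> : w = w' by [].
by apply/funext => i; have := e i => /addnI.
Qed.

Lemma half_coord x : net x -> forall i, 2 * x ord0 i \is a Num.int.
Proof.
move=> [Zx i|[u _ ->] i]; first by rewrite rpredM ?natr_int.
rewrite !mxE eqxx /= mulrDr rpredD//; first by rewrite -natrM natr_int.
by rewrite mulrA mulfV// mul1r natr_int.
Qed.

(** All coordinates are half-integers, so two that differ do so by at least [1 / 2]. *)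
Lemma net_separated x y : net x -> net y -> x != y -> 2^-1 <= norm2 (x - y).
Proof.
move=> nx ny xy.
have [i xyi] : exists i, x ord0 i != y ord0 i.
  apply: contrapT => h; case/negP: xy; apply/eqP/rowP => i.
  by apply: contrapT => /eqP xyi; apply: h; exists i.
apply: le_trans (ler_coord_norm2 _ i); rewrite !mxE.
have := half_coord nx i => /intrP[a ax]; have := half_coord ny i => /intrP[b bx].
have : x ord0 i - y ord0 i = (a - b)%:~R / 2 by rewrite intrB -ax -bx; field.
move=> e; rewrite e normrM -intr_norm (ger0_norm (_ : 0 <= 2^-1)) ?invr_ge0//.
rewrite ler_peMl ?invr_ge0// -[1]/(1%:~R) ler_int.
rewrite -gtz0_ge1 normr_gt0; apply: contraNneq xyi => ab.
by rewrite -subr_eq0 e ab mul0r.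
Qed.

Lemma net_separated_net : separated_net net.
Proof.
exists d%:R, 2^-1; split.
- by rewrite ltr0n.
- by rewrite invr_gt0.
- exact: net_separated.
move=> z; pose y : 'rV[R]_d := \row_i (Num.floor (z ord0 i))%:~R.
apply: ge_ereal_inf; exists (norm2 (z - y))%:E.
  by exists y => //; left=> i; rewrite mxE; apply/intrP; eexists.
rewrite lee_fin -[leRHS]mulr1; apply: norm2_le_coord => // i; rewrite !mxE.
by have := floor_itv (z ord0 i); rewrite intrD ler_norml => /andP[h1 h2]; lra.
Qed.

(** In box [n] the coordinate [i1] is at most [1 / n] times the coordinate [i0]. Hence the extra
    points in a large ball have [i1] coordinate at most [M / (2 * k)]: boxes beyond [2 * k] by this
    ratio, the earlier ones by the size of [M]. The factor 2 absorbs rounding and leaves a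
    proportion [1 / k]. *)
Lemma extra_density (eps : R) : 0 < eps ->
  exists rho0 : R, forall rho, rho0 <= rho ->
  (counting (extra_points `&` cball2 rho) <= (eps * rho ^+ d)%:E)%E.
Proof.
move=> e0.
have [k k0 kR] : exists2 k : nat, (0 < k)%N & 2 ^+ d / eps <= k%:R.
  by exists (Num.truncn (2 ^+ d / eps)).+1 => //; apply/ltW/truncnS_gt.
exists (Num.max 1 (4 * k * S (2 * k))%N%:R) => rho.
rewrite ge_max => /andP[rho1 rhok].
have rho0 : 0 <= rho by exact: le_trans rho1.
pose M := Num.truncn rho.
have Mrho : M%:R <= rho by have /andP[] := truncn_itv rho0.
have kM : (4 * k * S (2 * k) <= M)%N.
  by rewrite -ltnS -(ltr_nat R) (le_lt_trans rhok)// truncnS_gt.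
pose Q := [pred t : {ffun 'I_d -> 'I_M.+1} | (t i1 <= M %/ (2 * k))%N].
have [|_] := @counting_image_le R 'rV[R]_d {ffun 'I_d -> 'I_M.+1} Q
  (fun t => \row_i (t i)%:R + half) (extra_points `&` cball2 rho).
  move=> x [[u uE ->] ux].
  have uM i : (u i <= M)%N.
    rewrite truncn_ge_nat//; apply: le_trans ux.
    apply: le_trans (ler_coord_norm2 _ i).
    apply: le_trans (ler_norm _); rewrite !mxE lerDl.
    by rewrite mulr_ge0// invr_ge0.
  exists [ffun i => Ordinal (uM i : u i < M.+1)%N]; last first.
    by congr (_ + _); apply/rowP => i; rewrite !mxE ffunE.
  rewrite inE ffunE /= leq_divRL//; last by rewrite muln_gt0.
  have [n [w [n0 wl _ uw]]] := uE.
  have := uM i0; have := uw i0; rewrite eqxx mul1n => u0.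
  have := uw i1; rewrite eq_sym (negbTE i01) mul0n add0n => u1.
  have := wl i1; rewrite -u1 => wl1 u0M.
  have [nk|kn] := leqP n (2 * k).
    apply: leq_trans kM.
    rewrite (_ : 4 * k * _ = (2 * S (2 * k)) * (2 * k))%N; last by ring.
    rewrite leq_mul2r; apply/orP; right; apply: leq_trans (ltnW wl1) _.
    by rewrite leq_mul2l leq_net_size.
  apply: leq_trans u0M; rewrite u0; apply: leq_trans (leq_addr _ _).
  rewrite [(2 * n)%N]mulnC -mulnA mulnC; apply: leq_mul; exact: ltnW.
move=> /le_trans; apply; rewrite lee_fin.
have cardQ : (#|Q| * k <= M.+1 ^ d)%N.
  apply: (@card_ffun_coord d M.+1 i1 [pred x : 'I_M.+1 | x <= M %/ (2 * k)]%N).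
  rewrite (card_ordE M.+1 (fun x => x < (M %/ (2 * k)).+1)%N) sum_ltn_minn.
  apply: (@leq_trans ((M %/ (2 * k)).+1 * k)).
    by rewrite leq_mul2r geq_minr orbT.
  have h1 := leq_divM M (2 * k).
  have h2 : (2 * k <= M)%N.
    apply: leq_trans kM; rewrite (_ : 4 * k * _ = 2 * S (2 * k) * (2 * k))%N.
      by rewrite leq_pmull// muln_gt0 net_size_gt0// muln_gt0 k0.
    by ring.
  move: h1 h2; move: (M %/ (2 * k))%N => c; rewrite mulnCA [(c.+1 * _)%N]mulSn.
  by move: (c * k)%N => ck h1 h2; lia.
have kR0 : 0 < k%:R :> R by rewrite ltr0n.
rewrite -(ler_pM2r kR0); apply: le_trans (_ : (M.+1 ^ d)%N%:R <= _).
  by rewrite -natrM ler_nat.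
rewrite natrX; apply: le_trans (_ : (2 * rho) ^+ d <= _).
  apply: lerXn2r; rewrite ?nnegrE ?mulr_ge0// -natr1 mulr2n mulrDl mul1r.
  exact: lerD.
rewrite exprMn mulrAC ler_wpM2r ?exprn_ge0//.
by rewrite mulrC -ler_pdivrMr.
Qed.

Lemma net_density : natural_density net 1.
Proof. by apply: natural_density_lattice_setU => eps; exact: extra_density. Qed.

End Net.

(** * Irregularity of the net *)

Section NetIrregular.
Variables (R : realType) (d : nat) (i0 i1 : 'I_d).
Hypothesis i01 : i0 != i1.
Local Notation Zd := (@integer_lattice R d).
Local Notation net := (@net R d i0 i1).
Local Notation S := (net_size d).

Let d_gt0 : (0 < d)%N := ord_dim_gt0 i0.

(** The corner of the [n]-th box with least coordinates, at which the pattern is anchored. *)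
Definition net_center (n : nat) : 'rV[R]_d :=
  \row_i ((i == i0) * (2 * n * S n))%N%:R.

Definition net_radius (n : nat) : nat := 8 * d * n * S n.

Lemma norm2_pt_le n w b : (0 < n)%N -> (forall i, w i < 2 * S n)%N ->
  norm2 (pt i0 (net_center n) w b) <= (net_radius n)%:R.
Proof.
move=> n0 wl; have S0 := net_size_gt0 d_gt0 n0.
rewrite (_ : net_radius n = d * (8 * n * S n))%N; last by rewrite /net_radius; ring.
rewrite natrM; apply: norm2_le_coord => // i.
rewrite ptE mxE -natrD.
have h : ((i == i0) * (2 * n * S n) + w i + 1 <= 8 * n * S n)%N.
  have := wl i; have : (S n <= n * S n)%N by rewrite leq_pmull.
  by case: (i == i0); rewrite ?mul0n ?mul1n; nia.
rewrite ger0_norm; last by rewrite addr_ge0// !mulr_ge0// invr_ge0.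
apply: le_trans (_ : ((i == i0) * (2 * n * S n) + w i + 1)%N%:R <= _); last first.
  by rewrite ler_nat.
rewrite [X in _ <= X]natrD lerD2l.
by case: b (i == i0) => -[]; rewrite /=; lra.
Qed.

Lemma ln_natr_le (m : nat) : (0 < m)%N -> ln m%:R <= m%:R :> R.
Proof.
move=> m0; have m0R : 0 < m%:R :> R by rewrite ltr0n.
have := @le_ln1Dx R (m%:R - 1); rewrite [1 + _]addrC subrK => h.
by apply: le_trans (h _) _; lra.
Qed.

Lemma ln_net_radius_le : exists2 C : R, 0 < C &
  forall n, (0 < n)%N -> ln (net_radius n)%:R <= C * n%:R ^+ (12 + 4 * d).
Proof.
have [C C0 hC] := net_exponent_le d_gt0.
exists ((8 * d + C)%N%:R); first by rewrite ltr0n addn_gt0 C0 orbT.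
move=> n n0; have S0 := net_size_gt0 d_gt0 n0.
have q0 := net_q_gt0 d_gt0 n0; have N0 := net_N'_gt0 d_gt0 n0.
have dn0 : (0 < 8 * d * n)%N by rewrite !muln_gt0 d_gt0.
rewrite /net_radius natrM lnM ?posrE ?ltr0n//.
rewrite natrD mulrDl; apply: lerD.
  apply: le_trans (ln_natr_le dn0) _.
  rewrite -natrX -natrM ler_nat leq_mul2l; apply/orP; right.
  by rewrite -{1}(expn1 n) leq_pexp2l.
rewrite /net_size /side natrX lnXn; last by rewrite ltr0n muln_gt0 q0.
rewrite -natrX -natrM.
apply: le_trans (_ : ((net_T d n).+1 * (net_q d n * net_N' d n))%N%:R <= _).
  rewrite -[leLHS]mulr_natl [leRHS]natrM ler_wpM2l//.
  by apply: ln_natr_le; rewrite muln_gt0 q0.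
by rewrite ler_nat hC.
Qed.

(** The logarithm of the radius reaching box [n] has degree [P] in [n], so its power [1 / (2 * P)]
    is of order the square root of [n]. For large [n] both [f] and [g] are [n]-Lipschitz where box
    [n] needs it. *)
Lemma net_irregular (omega : modulus R) :
  (exists a : R, 0 < a /\ forall t : R, 0 < t < a -> t < modulus_dom omega ->
     omega t = t * ln (1 / t) `^ (2 * (12 + 4 * d)%N%:R)^-1) ->
  irregular omega net.
Proof.
set P := (12 + 4 * d)%N; set alpha := (2 * _)^-1.
move=> [a0 [a00 omE]] [f [g [[fXZ finj fsurj] gf hf hg]]].
have al0 : 0 <= alpha by rewrite invr_ge0 mulr_ge0.
have Zdnet : Zd `<=` net by move=> x; left.
have [K [C [K0 C1 hK]]] := homogeneous_lipschitz al0 a00 omE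
  (@net_separated R d i0 i1) hf.
have [K' [C' [K'0 C'1 hK']]] := homogeneous_lipschitz al0 a00 omE
  (fun x y Zx Zy => @net_separated R d i0 i1 x y (Zdnet x Zx) (Zdnet y Zy)) hg.
have [B B0 hB] := ln_net_radius_le.
have lnC : 0 <= ln C by exact: ln_ge0.
have lnC' : 0 <= ln C' by exact: ln_ge0.
have P0 : (0 < P)%N by [].
have [n1 hn1] := powR_root_le P0 K0 (ltr_wpDl lnC B0).
have [n2 hn2] := powR_root_le P0 K'0 (ltr_wpDl lnC' (mulr_gt0 (ltr0Sn R 1) B0)).
(* Beyond both thresholds, and above the norm of [f 0], which locates the image of the box. *)
pose n := (n1 + n2 + (Num.truncn (norm2 (f 0%R))).+1)%N.
have n0 : (0 < n)%N by rewrite /n addnS.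
have nR1 : 1 <= n%:R :> R by rewrite ler1n.
have f0n : norm2 (f 0) <= n%:R.
  by apply/ltW/(lt_le_trans (truncnS_gt _)); rewrite ler_nat leq_addl.
have S0 := net_size_gt0 d_gt0 n0.
pose rho : R := (net_radius n)%:R.
have rho_n : 8 * n%:R <= rho.
  rewrite -natrM ler_nat /net_radius (_ : 8 * d * n * _ = 8 * n * (d * S n))%N.
    by rewrite leq_pmulr// muln_gt0 d_gt0.
  by ring.
have S_rho : (S n)%:R <= rho.
  by rewrite ler_nat leq_pmull// !muln_gt0 d_gt0.
have rho1 : 1 <= rho by lra.
have rho0 : 0 < rho by lra.
have nP1 : 1 <= n%:R ^+ P :> R by exact: exprn_ege1.
have lnrho : ln rho <= B * n%:R ^+ P by exact: hB.
have lip_f x y : net x -> net y -> norm2 x <= rho -> norm2 y <= rho ->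
    norm2 (f x - f y) <= n%:R * norm2 (x - y).
  move=> nx ny xr yr; apply: le_trans (hK rho rho1 x y nx ny xr yr) _.
  rewrite ler_wpM2r ?norm2_ge0//; apply: hn1.
  - by rewrite /n -addnA leq_addr.
  - by apply: ln_ge0; nra.
  rewrite lnM ?posrE//; last lra.
  rewrite mulrDl lerD//.
  by rewrite ler_peMr.
(* [g] is applied at points of norm at most [n + n * rho + rho], which is below [rho ^+ 2]; the
   larger radius merely doubles the logarithm. *)
have lip_g x y : Zd x -> Zd y -> norm2 x <= rho ^+ 2 -> norm2 y <= rho ^+ 2 ->
    norm2 (g x - g y) <= n%:R * norm2 (x - y).
  have rho21 : 1 <= rho ^+ 2 by exact: exprn_ege1.
  move=> nx ny xr yr; apply: le_trans (hK' _ rho21 x y nx ny xr yr) _.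
  rewrite ler_wpM2r ?norm2_ge0//; apply: hn2.
  - by rewrite /n addnAC leq_addl.
  - by apply: ln_ge0; nra.
  rewrite lnM ?posrE ?exprn_gt0//; last lra.
  rewrite lnXn// mulrDl lerD//; first by rewrite ler_peMr.
  by rewrite -[leLHS]mulr_natl -[leRHS]mulrA ler_pM2l.
have gZ y : Zd y -> net (g y) /\ f (g y) = y.
  by move=> /fsurj[x nx <-]; rewrite gf.
have net0 : net 0 by left=> i; rewrite mxE rpred0.
apply: (@no_lipschitz_bijection R d i0 i1 n (net_q d n) (net_kappa d n)
  (net_T d n) (net_N' d n) i01 n0 (net_T_gt0 d_gt0 n0) erefl erefl erefl erefl
  (net_center n) net f g).
- by move=> i; rewrite mxE natr_int.
- move=> w b wl; case: b => [/(_ isT) pw|_].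
    right; exists (fun i => (i == i0) * (2 * n * S n) + w i)%N.
      by exists n, w.
    by rewrite /pt scale1r; congr (_ + _); apply/rowP => i; rewrite !mxE natrD.
  left=> i; rewrite ptE mxE mul0r addr0 -natrD; exact: natr_int.
- move=> x [Zx|[u eu ->]].
    by exists x, false; split=> //; rewrite scale0r addr0.
  exists (\row_i (u i)%:R), true; split.
  + by move=> i; rewrite mxE natr_int.
  + by rewrite scale1r.
  move=> w wl e _; apply: (extraP i01 n0 wl).
  suff <- : u = (fun i => (i == i0) * (2 * n * S n) + w i)%N by [].
  apply/funext => i; have /rowP/(_ i) := e.
  by rewrite ptE !mxE mul0r addr0 -natrD => /eqP; rewrite eqr_nat => /eqP.
- exact: fXZ.
- by move=> y /gZ[].
- by move=> y /gZ[].
- exact: gf.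
- by move=> w b w' b' wl wl' nx ny; apply: lip_f => //; exact: norm2_pt_le.
move=> w y wl Zy yf.
set x := pt i0 (net_center n) w false in yf *.
have nx : net x.
  left=> i; rewrite ptE mxE mul0r addr0 -natrD; exact: natr_int.
have xr : norm2 x <= rho by exact: norm2_pt_le.
have fx : norm2 (f x) <= n%:R + n%:R * rho.
  rewrite -[f x](subrK (f 0)); apply: le_trans (ler_norm2D _ _) _.
  rewrite addrC lerD//; apply: le_trans (lip_f _ _ nx net0 xr _) _.
    by rewrite norm2_0 ltW.
  by rewrite subr0 ler_wpM2l.
have yr : norm2 y <= rho ^+ 2.
  rewrite -[y](subrK (f x)); apply: le_trans (ler_norm2D _ _) _.
  have := le_trans yf S_rho; rewrite expr2.
  by nra.
rewrite -[X in norm2 (_ - X)](gf _ nx); apply: lip_g => //; first exact: fXZ.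
by rewrite expr2; apply: le_trans fx _; nra.
Qed.

End NetIrregular.

Unset Implicit Arguments.

Theorem proposition1p4 (R : realType) (d : nat) (hd : (2 <= d)%N) :
  exists (alpha0 : R) (X : set 'rV[R]_d),
    [/\ 0 < alpha0,
        separated_net X,
        (forall omega : modulus R,
           (exists a : R, 0 < a /\
              forall t : R, 0 < t < a -> t < modulus_dom omega ->
                omega t = t * ln (1 / t) `^ alpha0) ->
           irregular omega X)
      & natural_density X 1].
Proof.
(* Two directions are needed: stripes alternate along [i0] and slabs repeat along [i1]. *)
pose i0 := Ordinal (leq_trans (isT : (0 < 2)%N) hd).
pose i1 := Ordinal (leq_trans (isT : (1 < 2)%N) hd).
have i01 : i0 != i1 by [].
exists (2 * (12 + 4 * d)%N%:R)^-1, (@net R d i0 i1); split.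
- by rewrite invr_gt0 mulr_gt0.
- exact: net_separated_net.
- by move=> omega; exact: net_irregular.
- by apply: net_density.
Qed.
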